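(* Let $R=k[\mathbf{X}]/\mathfrak{a}=k[X_0,\ldots,X_n]/\mathfrak{a}$ and let $\mathfrak{F}:\mathbf{f}\subset R$ be an $m$-targeted rational map. For every minimal prime $P$ of $R$, let $\mathfrak{F}|_P$ denote the induced $m$-targeted rational map with source $R/P$ (represented by the residues of $\mathbf{f}$ in $R/P$). The following conditions are equivalent: (a) $\mathfrak{F}$ is birational onto its image. (b) $\mathfrak{F}$ has a (non-degenerate) Jacobian dual rank, and it satisfies $\mathrm{jdrank}_+(\mathfrak{F})=\mathrm{edim}(R)-1$. (c) For every minimal prime $P$ of $R$, $\mathfrak{F}|_P$ has a (non-degenerate) Jacobian dual rank, and it satisfies $\mathrm{jdrank}_+(\mathfrak{F}|_P)=\mathrm{edim}(R/P)-1$. Supplement. Suppose moreover that these equivalent conditions hold, and let $\psi$ be a weak Jacobian dual matrix of $\mathfrak{F}$ over $S=k[\mathbf{Y}]/\mathfrak{b}\simeq k[\mathbf{f}]$. Then: (i) A rational $(n+1)$-datum in $S$ representing the inverse map is given by the coordinates of any homogeneous vector of positive degree in the (rank one) null space of $\psi$ over $S$ for which these coordinates generate an ideal containing a regular element. (ii) If further $R$ is a domain, a rational $(n+1)$-datum as in (i) can be taken to be the set of the (ordered, signed) $(\mathrm{edim}(R)-1)$-minors of an arbitrary $(\mathrm{edim}(R)-1)\times\mathrm{edim}(R)$ submatrix of $\psi$ of rank $\mathrm{edim}(R)-1$.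
   Context: Setting. $k$ is an arbitrary field; $R=k[X_0,\ldots,X_n]/\mathfrak{a}=k[x_0,\ldots,x_n]$ is a reduced standard graded $k$-algebra ($\mathfrak{a}$ homogeneous) with $\dim R\ge 1$. $\mathrm{edim}(R):=\dim_k R_1=n+1-\dim_k\mathfrak{a}_1$ and $\mathrm{dgi}(\mathfrak{a}):=n+1-\mathrm{edim}(R)=\dim_k\mathfrak{a}_1$. Rational maps. Two ordered sets $\mathbf{f}=\{f_0,\ldots,f_m\}$, $\mathbf{f}'=\{f'_0,\ldots,f'_m\}$ of forms in $R$ (each set consisting of forms of one same degree) are equivalent if there are regular homogeneous elements $F,F'\in R$ with $Ff'_j=F'f_j$ for all $j$. A rational $(m+1)$-datum of degree $d$ on $R$ is an ordered set $\mathbf{f}=\{f_0,\ldots,f_m\}\subset R$ of forms of the same degree $d\geq 1$ such that (1) $R$ is torsionfree over the subring $k[\mathbf{f}]$ (i.e. every minimal prime of $R$ contracts to a minimal prime of $k[\mathbf{f}]$), and (2) the ideal $(\mathbf{f})R$ is not contained in any minimal prime of $R$. An $m$-targeted rational map $\mathfrak{F}$ with source $\mathrm{Proj}(R)$ (or, for short, source $R$) is an equivalence class of rational $(m+1)$-data; its members are its representatives, and one writes $\mathfrak{F}:\mathbf{f}\subset R$. All representatives share a common standard graded presentation $S=k[\mathbf{Y}]/\mathfrak{b}=k[Y_0,\ldots,Y_m]/\mathfrak{b}\simeq k[\mathbf{f}]$, $Y_j\mapsto f_j$ (after degree renormalization); $\mathrm{Proj}(S)\subset\mathbb{P}^m_k$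 is the image. For $\mathfrak{F}|_P$ the ring $S$ is replaced by $k[\mathbf{f}]/(P\cap k[\mathbf{f}])$ and $R$ by $R/P$, presented as a quotient of $k[X_0,\ldots,X_n]$. Birationality. $\mathfrak{F}:\mathbf{f}\subset R$ is birational (onto the image) if there is an $n$-targeted rational map $\mathfrak{G}:\mathbf{g}=\{g_0,\ldots,g_n\}\subset S$ such that $\mathbf{g}(\mathbf{f})=\{g_0(\mathbf{f}),\ldots,g_n(\mathbf{f})\}\subset R$ is equivalent to $\{x_0,\ldots,x_n\}$; $\mathfrak{G}$ is then called the inverse. Jacobian dual rank. Let $\mathcal{J}=\ker(R[\mathbf{Y}]\to\mathcal{R}_R((\mathbf{f})))$, $Y_j\mapsto f_jt$, where $\mathcal{R}_R((\mathbf{f}))=R[\mathbf{f}t]$ is the Rees algebra of the ideal $(\mathbf{f})$. It is bihomogeneous for the bigrading in which $x_i$ has bidegree $(1,0)$ and $Y_j$ has bidegree $(0,1)$; let $\mathcal{J}_{1,*}=\bigoplus_{q}\mathcal{J}_{1,q}$ and let $(\mathcal{J}_{1,*})\subset R[\mathbf{Y}]$ be the ideal it generates. Choose a minimal set of generators of $(\mathcal{J}_{1,*})$ consisting of forms of bidegrees $(1,q)$ for various $q$, lift them to forms $P_1,\ldots,P_s\in k[\mathbf{X},\mathbf{Y}]$ of the same bidegrees, and let $\ell_1,\ldots,\ell_r$ be a $k$-basis of $\mathfrak{a}_1$. The Jacobian matrix of $\{\ell_1,\ldots,\ell_r,P_1,\ldots,P_s\}$ with respect to $X_0,\ldots,X_n$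 (rows indexed by the polynomials, columns by the $X_i$) has entries in $k[\mathbf{Y}]$; the corresponding matrix $\psi$ over $S$ is called a weak Jacobian (dual) matrix, or Jacobian dual matrix, of $\mathfrak{F}$. A matrix over a ring has rank $\rho$ if all its minors of size $>\rho$ vanish and the ideal of its $\rho$-minors contains a regular element. $\mathfrak{F}$ has a Jacobian dual rank if some (equivalently, every) Jacobian dual matrix $\psi$ has a rank over $S$; this rank is $\mathrm{jdrank}(\mathfrak{F})$, and the non-degenerate Jacobian dual rank is $\mathrm{jdrank}_+(\mathfrak{F}):=\mathrm{jdrank}(\mathfrak{F})-\mathrm{dgi}(\mathfrak{a})$.
   Formalization: (c) also requires distinct minimal primes of R to have distinct contractions to k[f]; without it (c)⇒(a) fails for k[x,y,z]/(xy), f=(x+y,z). (ii) takes n×(n+1) submatrices of rank n (the same if dgi(a)=0) and assumes edim(R)>1, as otherwise the minors have degree 0. *)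

(* Defs.v *)
From HB Require Import structures.
From mathcomp Require Import all_boot all_order all_algebra.
From mathcomp Require Import generic_quotient ring_quotient.
From mathcomp Require Export mpoly.
From Stdlib Require Import ClassicalEpsilon.

Set Implicit Arguments.
Unset Strict Implicit.
Unset Printing Implicit Defensive.

Import GRing.Theory.

Local Open Scope ring_scope.
Local Open Scope quotient_scope.

Section CommutativeAlgebra.
Variable A : comNzRingType.

Definition ideal_gen (G : A -> Prop) (x : A) : Prop :=
  exists t (c g : 'I_t -> A), (forall i, G (g i)) /\ x = \sum_i c i * g i.

Definition min_gens (s : nat) (g : 'I_s -> A) (I : A -> Prop) : Prop :=
  (forall x, ideal_gen (fun y => exists i, y = g i) x <-> I x) /\
  (forall i, ~ (forall x, I x ->
     ideal_gen (fun y => exists2 j, j <> i & y = g j) x)).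

Definition reduced : Prop := forall (x : A) (e : nat), x ^+ e = 0 -> x = 0.

Definition is_domain : Prop := forall x y : A, x * y = 0 -> x = 0 \/ y = 0.

Definition krull_dim_ge (d : nat) : Prop :=
  exists p : 'I_d.+1 -> prime_idealr A, forall i j : 'I_d.+1, (i < j)%N ->
    {subset p i <= p j} /\ ~ {subset p j <= p i}.

Definition minimal_prime (P : prime_idealr A) : Prop :=
  forall Q : prime_idealr A, {subset Q <= P} -> {subset P <= Q}.

Definition torsionfree_over (B : A -> Prop) : Prop :=
  forall b, B b -> (forall c, B c -> b * c = 0 -> c = 0) -> GRing.lreg b.

(* Repeated or unordered row and column indices only add minors that are 0 or
   agree up to sign with genuine ones. *)
Definition has_rank (p q : nat) (M : 'M[A]_(p, q)) (rho : nat) : Prop :=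
  (forall t (f : 'I_t -> 'I_p) (g : 'I_t -> 'I_q), (rho < t)%N ->
     \det (mxsub f g M) = 0) /\
  exists2 c, GRing.lreg c &
    ideal_gen (fun x => exists (f : 'I_rho -> 'I_p) (g : 'I_rho -> 'I_q),
                 x = \det (mxsub f g M)) c.

Definition null_space (p q : nat) (M : 'M[A]_(p, q)) (v : 'cV[A]_q) : Prop :=
  M *m v = 0.

(* Over the total ring of fractions, N becomes free with basis v. *)
Definition has_rank_one (q : nat) (N : 'cV[A]_q -> Prop) : Prop :=
  exists v, [/\ N v, forall c, c *: v = 0 -> c = 0 &
    forall w, N w -> exists c d, GRing.lreg c /\ c *: w = d *: v].

Definition signed_minor (n : nat) (M : 'M[A]_(n, n.+1)) (j : 'I_n.+1) : A :=
  (-1) ^+ j * \det (col' j M).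

Section Preimage.
Variables (I : idealr A) (P : idealr {ideal_quot I}).

Definition preim_pred : A -> bool := fun x => \pi_{ideal_quot I} x \in P.

Fact preim_pred_closed : idealr_closed preim_pred.
Proof.
have inE' x : (x \in preim_pred) = (\pi_{ideal_quot I} x \in P) by [].
split=> [||a u v]; rewrite !inE'.
- by rewrite rmorph0 rpred0.
- by rewrite rmorph1 idealr1.
by move=> Pu Pv; rewrite rmorphD rmorphM rpredD ?idealMr.
Qed.

HB.instance Definition _ := isIdealr.Build A preim_pred preim_pred_closed.

Definition preim_ideal : idealr A := preim_pred.
End Preimage.

End CommutativeAlgebra.
Arguments reduced : clear implicits.
Arguments is_domain : clear implicits.
Arguments krull_dim_ge : clear implicits.

Section RationalMaps.
Variable k : fieldType.

Definition homogeneous_ideal (n : nat) (a : idealr {mpoly k[n.+1]}) : Prop :=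
  forall p d, p \in a -> pihomog mdeg d p \in a.

(* Forms of R = k[X]/a are given by forms of k[X], read modulo a. In this way
   the same family f represents a map with source R and its restrictions to the
   components R/P. *)
Definition subst (n m : nat) (f : 'I_m -> {mpoly k[n]}) (q : {mpoly k[m]}) :
  {mpoly k[n]} := q \mPo [tuple f j | j < m].

Section ImageIdeal.
Variables (n m : nat) (a : idealr {mpoly k[n.+1]}).
Variable f : 'I_m.+1 -> {mpoly k[n.+1]}.

Definition image_pred : {mpoly k[m.+1]} -> bool := fun q => subst f q \in a.

Fact image_pred_closed : idealr_closed image_pred.
Proof.
have inE' q : (q \in image_pred) = (subst f q \in a) by [].
split=> [||c u v]; rewrite !inE' /subst.
- by rewrite rmorph0 rpred0.
- by rewrite rmorph1 idealr1.
by move=> au av; rewrite rmorphD rmorphM rpredD ?idealMr.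
Qed.

HB.instance Definition _ :=
  isIdealr.Build {mpoly k[m.+1]} image_pred image_pred_closed.

(* The ideal b of the presentation S = k[Y]/b of k[f]. *)
Definition image_ideal : idealr {mpoly k[m.+1]} := image_pred.
End ImageIdeal.

Section Source.
Variables (n : nat) (a : idealr {mpoly k[n.+1]}).
Local Notation R := {ideal_quot a}.
Local Notation res := (\pi_R).

Definition rational_datum (m d : nat) (f : 'I_m.+1 -> {mpoly k[n.+1]}) : Prop :=
  [/\ (0 < d)%N,
      forall j, f j \is d.-homog,
      torsionfree_over (fun x : R => exists q, x = res (subst f q)) &
      forall P : prime_idealr R, minimal_prime P -> exists j, res (f j) \notin P].

Definition rat_equiv (m : nat) (f f' : 'I_m.+1 -> {mpoly k[n.+1]}) : Prop :=
  exists F F' : {mpoly k[n.+1]},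
    [/\ exists e, F \is e.-homog, exists e, F' \is e.-homog,
        GRing.lreg (res F), GRing.lreg (res F') &
        forall j, res (F * f' j) = res (F' * f j)].

Definition a1_basis (r : nat) (l : 'I_r -> {mpoly k[n.+1]}) : Prop :=
  [/\ forall i, l i \is 1.-homog /\ l i \in a,
      forall c : 'I_r -> k, \sum_i c i *: l i = 0 -> forall i, c i = 0 &
      forall p, p \is 1.-homog -> p \in a ->
        exists c : 'I_r -> k, p = \sum_i c i *: l i].

(* dim_k a_1; accordingly edim below is dim_k R_1. *)
Definition dgi : nat :=
  epsilon (inhabits 0%N)
    (fun r => exists l : 'I_r -> {mpoly k[n.+1]}, a1_basis l).

Definition edim : nat := n.+1 - dgi.

End Source.

Section Birational.
Variables (n m : nat) (a : idealr {mpoly k[n.+1]}).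
Variable f : 'I_m.+1 -> {mpoly k[n.+1]}.

Definition inverse_datum (e : nat) (g : 'I_n.+1 -> {mpoly k[m.+1]}) : Prop :=
  rational_datum (image_ideal a f) e g /\
  rat_equiv a (fun i => subst f (g i)) (fun i => 'X_i).

Definition birational : Prop := exists e g, inverse_datum e g.

End Birational.

Section JacobianDual.
Variables (n m : nat) (a : idealr {mpoly k[n.+1]}).
Variable f : 'I_m.+1 -> {mpoly k[n.+1]}.
Local Notation R := {ideal_quot a}.
Local Notation S := {ideal_quot (image_ideal a f)}.
(* k[X,Y] is k[X][Y]. *)
Local Notation kXY := {mpoly {mpoly k[n.+1]}[m.+1]}.

Definition bihomog (p q : nat) (P : kXY) : Prop :=
  P \is q.-homog /\ forall mu, P@_mu \is p.-homog.

Definition resY (P : kXY) : {mpoly R[m.+1]} := map_mpoly \pi_R P.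

Definition rees_map (Q : {mpoly R[m.+1]}) : {poly R} :=
  mmap polyC (fun j => \pi_R (f j) *: 'X) Q.

(* The union of the J_{1,q}, which generates the same ideal as their sum. *)
Definition J1 (Q : {mpoly R[m.+1]}) : Prop :=
  rees_map Q = 0 /\ exists q P, bihomog 1 q P /\ Q = resY P.

(* Only applied to P linear in X, whose X-derivatives lie in k[Y]; taking
   constant coefficients in X performs this identification. *)
Definition jac_entry (P : kXY) (i : 'I_n.+1) : S :=
  \pi_S (map_mpoly (mcoeff 0%MM) (map_mpoly (mderiv i) P)).

Definition jacobian_dual (r s : nat) (psi : 'M[S]_(r + s, n.+1)) : Prop :=
  exists (l : 'I_r -> {mpoly k[n.+1]}) (P : 'I_s -> kXY),
    [/\ a1_basis a l,
        forall i, exists q, bihomog 1 q (P i),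
        min_gens (fun i => resY (P i)) (ideal_gen J1) &
        psi = col_mx (\matrix_(i, j) jac_entry (l i)%:MP j)
                     (\matrix_(i, j) jac_entry (P i) j)].

Definition jdrank_is (rho : nat) : Prop :=
  exists r s (psi : 'M[S]_(r + s, n.+1)), jacobian_dual psi /\ has_rank psi rho.

Definition jdrank_plus_is (e : int) : Prop :=
  exists2 rho, jdrank_is rho & e = rho%:Z - (dgi a)%:Z.

(* Vectors over S are given by representatives in k[Y]. *)
Definition homogeneous_null_vector (p : nat) (psi : 'M[S]_(p, n.+1))
    (e : nat) (h : 'I_n.+1 -> {mpoly k[m.+1]}) : Prop :=
  [/\ (0 < e)%N, forall i, h i \is e.-homog,
      null_space psi (\col_i \pi_S (h i)) &
      exists2 c, GRing.lreg c &
        ideal_gen (fun x => exists i, x = \pi_S (h i)) c].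

(* Distinct minimal primes of R have distinct contractions to k[f], i.e. distinct
   components have distinct images. The restrictions to the components do not
   see this: for R = k[x,y,z]/(xy) and f = (x+y, z) both of them are isomorphisms
   onto the projective line, although the map itself has degree 2. *)
Definition separates_components : Prop :=
  forall P Q : prime_idealr R, minimal_prime P -> minimal_prime Q ->
    image_ideal (preim_ideal P) f =i image_ideal (preim_ideal Q) f -> P =i Q.

End JacobianDual.

End RationalMaps.

(* Main.v *)
(* A row (Q_0, ..., Q_n) of the Jacobian dual matrix psi is a syzygy with
   coefficients in S = k[f] of the variables: sum_i x_i Q_i(f) = 0 in R. The forms
   l_j and P_i generate, in degree one in X, all such homogeneous syzygies up to
   a_1, so the rows of psi span the homogeneous S-linear syzygies of x. Hence the
   (n+1)-minors of psi always vanish, and psi has rank n iff its n-minors have zero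
   joint annihilator.
   - If g represents an inverse, then x_i g_j(f) = x_j g_i(f), so g_j e_i - g_i e_j
     are syzygies and g_j ^ n is an n-minor of their span.
   - If psi has rank n, signed minors combine into a homogeneous null vector h;
     since x is another null vector over R, Cramer's rule gives
     x_i h_j = x_j h_i, and F = sum_i m_i h_i, F' = sum_i m_i x_i are regular for
     suitable forms m_i.
   - A minimal prime P restricts to p in S, and some form z of S has annihilator p.
     When distinct components have distinct images, z lies in all minimal primes
     of R but P, so that z lifts the syzygies modulo P to syzygies over R.
   Prime avoidance is replaced throughout by a statement on annihilators in reduced
   Noetherian graded rings, obtained from Hilbert's basis theorem. *)

Require Import Defs.
From HB Require Import structures.
From mathcomp Require Import all_boot all_order all_algebra.
From mathcomp Require Import generic_quotient ring_quotient.
From mathcomp Require Import perm zify ring.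
From Stdlib Require Import Classical ClassicalEpsilon.

Set Implicit Arguments.
Unset Strict Implicit.
Unset Printing Implicit Defensive.

Import GRing.Theory.

Local Open Scope ring_scope.
Local Open Scope quotient_scope.

(** The obstacle is that regular elements must be exhibited: [has_rank] wants one in the ideal of
    minors, and [rat_equiv] wants homogeneous regular [F] and [F']. Over a finite field a
    combination of the given generators with constant coefficients may fail to be regular. The proof
    therefore works as long as possible with families of zero joint annihilator ([faithful]), a
    condition that survives Cramer's rule and multiplication of two families, and only at the end
    does [homogeneous_avoidance] turn such a family into one regular form. That step requires
    positive degrees. Minors made of the constant rows [l_j] can have degree 0, so minors are
    multiplied by the variables [Y_j] beforehand. Reducedness serves to discard powers: y x^e = 0
    implies y x = 0. Torsionfreeness carries regular elements from S to R. *)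

Lemma nat_least (P : nat -> Prop) :
  (exists n, P n) -> exists2 n, P n & forall m, P m -> (n <= m)%N.
Proof.
case=> n; elim/ltn_ind: n => n IHn Pn.
have [[m [lt_mn Pm]]|nP] := classic (exists m, (m < n)%N /\ P m).
  exact: IHn lt_mn Pm.
exists n => // m Pm; rewrite leqNgt; apply/negP => lt_mn.
by apply: nP; exists m.
Qed.

(** * Noetherian rings *)

Section Ideals.
Variable A : comNzRingType.
Implicit Types (I G : A -> Prop) (x y z : A).

Definition is_ideal I : Prop :=
  I 0 /\ forall c x y, I x -> I y -> I (c * x + y).

Lemma ideal_sum I t (c g : 'I_t -> A) :
  is_ideal I -> (forall i, I (g i)) -> I (\sum_i c i * g i).
Proof.
case=> I0 Il Ig; elim/big_rec: _ => // i x _ Ix.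
exact: Il (Ig i) Ix.
Qed.

Lemma idealM I c x : is_ideal I -> I x -> I (c * x).
Proof. by case=> I0 Il Ix; rewrite -[c * x]addr0; apply: Il. Qed.

Lemma idealD I x y : is_ideal I -> I x -> I y -> I (x + y).
Proof. by case=> I0 Il Ix Iy; rewrite -[x]mul1r; apply: Il. Qed.

Lemma idealB I x y : is_ideal I -> I x -> I y -> I (x - y).
Proof. by case=> I0 Il Ix Iy; rewrite addrC -mulN1r; apply: Il. Qed.

Lemma ideal_gen_sub G x : G x -> ideal_gen G x.
Proof.
move=> Gx; exists 1%N, (fun=> 1), (fun=> x); split=> //.
by rewrite big_ord1 mul1r.
Qed.

Lemma ideal_gen_ideal G : is_ideal (ideal_gen G).
Proof.
split; first by exists 0%N, (fun=> 0), (fun=> 0); split=> [[]|] //; rewrite big_ord0.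
move=> c _ _ [s [a [g [Gg ->]]]] [t [b [h [Gh ->]]]].
exists (s + t)%N.
exists (fun i => match split i with inl j => c * a j | inr j => b j end).
exists (fun i => match split i with inl j => g j | inr j => h j end).
split=> [i|]; first by case: split.
rewrite big_split_ord /= mulr_sumr; congr (_ + _); apply: eq_bigr => i _.
  by rewrite -[lshift t i]/(unsplit (inl i)) unsplitK mulrA.
by rewrite -[rshift s i]/(unsplit (inr i)) unsplitK.
Qed.

Lemma ideal_gen0 G : ideal_gen G 0.
Proof. by case: (ideal_gen_ideal G). Qed.

Lemma ideal_gen_min G I :
  is_ideal I -> (forall x, G x -> I x) -> forall x, ideal_gen G x -> I x.
Proof.
move=> idI GI x [t [c [g [Gg ->]]]].
by apply: ideal_sum => // i; apply: GI.
Qed.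

Lemma ideal_gen_mono G G' :
  (forall x, G x -> G' x) -> forall x, ideal_gen G x -> ideal_gen G' x.
Proof.
move=> GG'; apply: ideal_gen_min; first exact: ideal_gen_ideal.
by move=> x /GG'; apply: ideal_gen_sub.
Qed.

Lemma ideal_gen_range (T : finType) (g : T -> A) x :
  ideal_gen (fun y => exists i, y = g i) x ->
  exists c : T -> A, x = \sum_i c i * g i.
Proof.
apply: (@ideal_gen_min _ (fun x => exists c : T -> A, x = \sum_i c i * g i)).
  split=> [|c _ _ [a ->] [b ->]].
    by exists (fun=> 0); rewrite big1 // => i _; rewrite mul0r.
  exists (fun i => c * a i + b i); rewrite mulr_sumr -big_split /=.
  by apply: eq_bigr => i _; rewrite mulrDl mulrA.
move=> _ [i ->]; exists (fun j => (j == i)%:R).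
by rewrite (bigD1 i) //= eqxx mul1r big1 ?addr0 // => j /negPf ->; rewrite mul0r.
Qed.

Lemma ideal_gen_fin (T : finType) (c g : T -> A) G :
  (forall i, G (g i)) -> ideal_gen G (\sum_i c i * g i).
Proof.
move=> Gg; elim/big_rec: _ => [|i x _ Ix].
  exact: ideal_gen0.
by case: (ideal_gen_ideal G) => _; apply=> //; apply: ideal_gen_sub.
Qed.

Definition noetherian : Prop := forall I, is_ideal I ->
  exists s (g : 'I_s -> A), (forall i, I (g i)) /\
    forall x, I x -> ideal_gen (fun y => exists i, y = g i) x.

(** Ascending chain condition for the ideals (u_0, ..., u_(N-1)): the finitely many generators of
    their union already lie in one of them. *)
Lemma noetherian_seq (u : nat -> A) : noetherian ->
  exists N, ideal_gen (fun y => exists2 i, (i < N)%N & y = u i) (u N).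
Proof.
move=> /(_ (ideal_gen (fun y => exists i, y = u i)) (ideal_gen_ideal _)).
case=> s [g [Ig gI]].
pose J N := ideal_gen (fun y => exists2 i, (i < N)%N & y = u i).
have Jmono M N x : (M <= N)%N -> J M x -> J N x.
  move=> leMN; apply: ideal_gen_mono => _ [i ltiM ->].
  by exists i => //; apply: leq_trans leMN.
have IJ x : ideal_gen (fun y => exists i, y = u i) x -> exists N, J N x.
  apply: (@ideal_gen_min _ (fun x => exists N, J N x)) => [|_ [i ->]]; last first.
    by exists i.+1; apply: ideal_gen_sub; exists i.
  split=> [|c y z [M JMy] [N JNz]].
    by exists 0%N; apply: ideal_gen0.
  exists (maxn M N); have [_ Jl] := ideal_gen_ideal
    (fun y => exists2 i, (i < maxn M N)%N & y = u i).
  by apply: Jl; [apply: Jmono JMy; apply: leq_maxl|apply: Jmono JNz; apply: leq_maxr].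
have [F JF] := fin_all_exists (fun i => IJ _ (Ig i)).
exists (\max_i F i); have := gI (u (\max_i F i)) (ideal_gen_sub (ex_intro _ _ erefl)).
apply: ideal_gen_min; first exact: ideal_gen_ideal.
move=> _ [i ->]; apply: Jmono (JF i); exact: leq_bigmax.
Qed.

(** Otherwise choice yields a strictly increasing chain of ideals, and elements picked in each
    successive difference contradict [noetherian_seq]. *)
Lemma noetherian_max (T : Type) (t0 : T) (I : T -> A -> Prop) :
  noetherian -> (forall t, is_ideal (I t)) ->
  exists t, forall t', (forall x, I t x -> I t' x) -> forall x, I t' x -> I t x.
Proof.
move=> noeA idI; apply: NNPP => nomax.
have next t : exists tx : T * A,
    [/\ forall x, I t x -> I tx.1 x, I tx.1 tx.2 & ~ I t tx.2].
  apply: NNPP => nonext; apply: nomax; exists t => t' Itt' x It'x.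
  by apply: NNPP => nItx; apply: nonext; exists (t', x).
pose nx t := proj1_sig (constructive_indefinite_description _ (next t)).
have nxP t : [/\ forall x, I t x -> I (nx t).1 x, I (nx t).1 (nx t).2 & ~ I t (nx t).2].
  exact: proj2_sig (constructive_indefinite_description _ (next t)).
pose tt := fix tt n := if n is n'.+1 then (nx (tt n')).1 else t0.
pose u n := (nx (tt n)).2.
have Imono m n x : (m <= n)%N -> I (tt m) x -> I (tt n) x.
  move=> /subnKC <-; elim: (n - m)%N => [|d IHd] Ix; first by rewrite addn0.
  by rewrite addnS /=; case: (nxP (tt (m + d)%N)) => + _ _; apply; apply: IHd.
have [N uN] := noetherian_seq u noeA.
have [_ _] := nxP (tt N); apply; move: uN.
apply: (@ideal_gen_min _ (I (tt N))) => // _ [i ltiN ->].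
by apply: (Imono i.+1) => //=; case: (nxP (tt i)).
Qed.

End Ideals.

Lemma noetherian_field (k : fieldType) : noetherian k.
Proof.
move=> I idI; have [[x [Ix x0]]|nI] := classic (exists x, I x /\ x != 0).
  exists 1%N, (fun=> x); split=> // y _.
  exists 1%N, (fun=> y / x), (fun=> x); split; first by exists ord0.
  by rewrite big_ord1 divfK.
exists 0%N, (fun=> 0); split=> [[]//|x Ix].
suff -> : x = 0 by apply: ideal_gen0.
by apply/eqP/negPn/negP => x0; apply: nI; exists x.
Qed.

Lemma noetherian_surj (A B : comNzRingType) (h : {rmorphism A -> B}) :
  (forall y, exists x, h x = y) -> noetherian A -> noetherian B.
Proof.
move=> hS noeA I idI; have [|s [g [Ig gI]]] := noeA (fun x => I (h x)).
  split=> [|c x y Ix Iy]; first by rewrite rmorph0; case: idI.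
  by rewrite rmorphD rmorphM; case: idI => _; apply.
exists s, (h \o g); split=> // y; have [x <-] := hS y => /gI /ideal_gen_range[c ->].
rewrite rmorph_sum; under eq_bigr do rewrite rmorphM.
by apply: (@ideal_gen_fin _ _ (fun i => h (c i)) (fun i => h (g i))) => i; exists i.
Qed.

Section HilbertBasis.
Variables (A : comNzRingType) (noeA : noetherian A).
Variables (I : {poly A} -> Prop) (idI : is_ideal I).

Let gen (l : seq {poly A}) := ideal_gen (fun y => y \in l).
Let next_spec l x := [/\ I x, ~ gen l x &
  forall y, I y -> ~ gen l y -> (size x <= size y)%N].
Let next l := epsilon (inhabits 0) (next_spec l).
Let L := fix L n := if n is n'.+1 then rcons (L n') (next (L n')) else [::].
Let u n := next (L n).

Let L_mkseq n : L n = mkseq u n.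
Proof. by elim: n => // n IHn; rewrite /= mkseqS -IHn. Qed.

(* The usual argument: u n is an element of least degree of I outside the ideal
   generated by u 0, ..., u (n - 1). *)
Lemma hilbert_basis_ideal : exists l : seq {poly A},
  (forall y, y \in l -> I y) /\ forall x, I x -> gen l x.
Proof.
apply: NNPP => nfg.
have nextP l : (forall y, y \in l -> I y) -> next_spec l (next l).
  move=> lI; apply: epsilon_spec.
  have [x [Ix nlx]] : exists x, I x /\ ~ gen l x.
    apply: NNPP => nx; apply: nfg; exists l; split=> // x Ix.
    by apply: NNPP => nlx; apply: nx; exists x.
  have [|d [z [Iz nlz sz]] dmin] := @nat_least
    (fun d => exists x, [/\ I x, ~ gen l x & size x = d]).
    by exists (size x), x.
  exists z; split=> // y Iy nly; rewrite sz; apply: dmin.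
  by exists y.
have LI n : forall y, y \in L n -> I y.
  elim: n => // n IHn y /=; rewrite mem_rcons in_cons => /orP[/eqP->|/IHn //].
  by case: (nextP _ IHn).
have uP n : next_spec (L n) (u n) by apply: nextP; apply: LI.
have Lmono i n : (i <= n)%N -> forall y, gen (L i) y -> gen (L n) y.
  move=> le_in y; apply: ideal_gen_mono => z; rewrite !L_mkseq.
  case/mapP=> j; rewrite mem_iota => /andP[_ ltji] ->.
  by apply: map_f; rewrite mem_iota /=; apply: leq_trans le_in.
have szu i n : (i <= n)%N -> (size (u i) <= size (u n))%N.
  move=> le_in; have [_ _ umin] := uP i; have [Iun nun _] := uP n.
  by apply: umin => // gi; apply: nun; apply: Lmono gi.
have u0 n : (0 < size (u n))%N.
  rewrite size_poly_gt0; apply/eqP => un0; have [_ nun _] := uP n.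
  by apply: nun; rewrite un0; apply: ideal_gen0.
have [N] := noetherian_seq (fun n => lead_coef (u n)) noeA.
case=> t [a [c [/fin_all_exists2[j ltjN cE] lN]]].
have [IuN nuN uNmin] := uP N.
(* The leading coefficient of [u N] is a combination of earlier ones; [w] is the same combination of
   the earlier polynomials, shifted to the degree of [u N], so that [u N - w] has smaller size. *)
pose w := \sum_i (a i *: 'X^(size (u N) - size (u (j i)))) * u (j i).
have Lw : gen (L N) w.
  apply: ideal_sum; first exact: ideal_gen_ideal.
  move=> i; apply: ideal_gen_sub; rewrite L_mkseq; apply: map_f.
  by rewrite mem_iota /=.
have Iw : I w.
  by move: Lw; apply: ideal_gen_min => // y; apply: LI.
have nz : ~ gen (L N) (u N - w).
  move=> gz; apply: nuN; rewrite -[u N](subrK w).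
  by apply: idealD => //; apply: ideal_gen_ideal.
have := uNmin _ (idealB idI IuN Iw) nz; apply/negP; rewrite -ltnNge.
rewrite -(prednK (u0 N)) ltnS; apply/leq_sizeP => i le_i.
have ci l : ((a l *: 'X^(size (u N) - size (u (j l)))) * u (j l))`_i =
    a l * (u (j l))`_(i - (size (u N) - size (u (j l)))).
  rewrite -scalerAl coefZ coefXnM; case: ltnP => // lt_i.
  by move: (u0 (j l)) (szu _ _ (ltnW (ltjN l))) le_i lt_i; lia.
rewrite coefB coef_sum; under eq_bigr do rewrite ci.
move: le_i; rewrite leq_eqVlt => /orP[/eqP<-|lt_i].
  rewrite -lead_coefE lN; apply/eqP; rewrite subr_eq0; apply/eqP.
  apply: eq_bigr => l _; rewrite cE lead_coefE; congr (_ * _`_ _).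
  by move: (u0 (j l)) (u0 N) (szu _ _ (ltnW (ltjN l))); lia.
rewrite (prednK (u0 N)) in lt_i; rewrite nth_default // sub0r.
rewrite big1 ?oppr0 // => l _.
have le_l : (size (u (j l)) <= i - (size (u N) - size (u (j l))))%N.
  by move: lt_i (szu _ _ (ltnW (ltjN l))); lia.
by rewrite nth_default ?mulr0.
Qed.

End HilbertBasis.

Lemma noetherian_poly (A : comNzRingType) : noetherian A -> noetherian {poly A}.
Proof.
move=> noeA I idI; have [l [lI Il]] := hilbert_basis_ideal noeA idI.
exists (size l), (fun i => l`_i); split=> [i|x /Il]; first exact/lI/mem_nth.
apply: ideal_gen_mono => y y_l; have lt_y : (index y l < size l)%N by rewrite index_mem.
by exists (Ordinal lt_y); rewrite /= nth_index.
Qed.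

(** Evaluating the variable of {poly {mpoly A[n]}} at the last variable is onto {mpoly A[n.+1]},
    with [muni] giving preimages. *)
Lemma noetherian_mpoly (A : comNzRingType) n :
  noetherian A -> noetherian {mpoly A[n]}.
Proof.
move=> noeA; elim: n => [|n IHn].
  apply: (@noetherian_surj A _ (@mpolyC 0 A)) noeA => p.
  by exists p@_0%MM; apply: esym (nvar0_mpolyC p).
pose h := horner_eval ('X_ord_max : {mpoly A[n.+1]}) \o @mpwiden n A.
apply: (@noetherian_surj _ _ h) (noetherian_poly IHn) => p; exists (muni p).
rewrite muniE rmorph_sum [RHS]mpolyE; apply: eq_bigr => m _.
rewrite /h /= mpwidenZ mwidenZ mwidenX /horner_eval hornerZ rmorphXn /=.
rewrite mpwidenX hornerXn -scalerAl mpolyXn -mpolyXD; congr (_ *: 'X_[_]).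
apply/mnmP => i; rewrite mnmDE mulmnE mnm1E.
case: (unliftP ord_max i) => [j ->|->].
  have -> : lift ord_max j = widen_ord (leqnSn n) j.
    by apply/val_inj; rewrite /= /bump leqNgt ltn_ord.
  by rewrite mnmwiden_widen mnmE -(inj_eq val_inj) /= gtn_eqF ?mul0n ?addn0.
by rewrite mnmwiden_ordmax eqxx mul1n.
Qed.

(** A maximal ideal among those generated by finite lists in [G] contains all of [G]. The generators
    stay inside [G], which matters when [G] consists of homogeneous elements. *)
Lemma noetherian_gens (A : comNzRingType) (G : A -> Prop) : noetherian A ->
  exists s (g : 'I_s -> A), (forall i, G (g i)) /\
    forall x, ideal_gen G x -> ideal_gen (fun y => exists i, y = g i) x.
Proof.
move=> noeA; pose T := {l : seq A | forall y, y \in l -> G y}.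
have t0 : T by exists [::].
have [[l lG] lmax] := noetherian_max t0 noeA
  (fun t : T => ideal_gen_ideal (fun y => y \in sval t)).
exists (size l), (fun i => l`_i); split=> [i|x]; first exact/lG/mem_nth.
apply: ideal_gen_min => [|y Gy]; first exact: ideal_gen_ideal.
have yG z : z \in y :: l -> G z by rewrite in_cons => /orP[/eqP->|/lG].
have := lmax (exist _ _ yG) _ y _ => /= l_y.
apply: (@ideal_gen_mono _ (fun y => y \in l)) => [z z_l|].
  have lt_z : (index z l < size l)%N by rewrite index_mem.
  by exists (Ordinal lt_z); rewrite /= nth_index.
apply: l_y; last by apply: ideal_gen_sub; rewrite mem_head.
by apply: ideal_gen_mono => z; rewrite in_cons orbC => ->.
Qed.

(** * Annihilators and minimal primes *)

Section Annihilators.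
Variable A : comNzRingType.
Implicit Types (x y z : A).

Definition annihilator z : A -> Prop := fun x => x * z = 0.

Definition faithful (T : Type) (x : T -> A) : Prop :=
  forall y, (forall i, y * x i = 0) -> y = 0.

Lemma annihilator_ideal z : is_ideal (annihilator z).
Proof.
split=> [|c x y]; rewrite /annihilator ?mul0r // => xz yz.
by rewrite mulrDl -mulrA xz yz mulr0 addr0.
Qed.

Lemma lreg_annP x : GRing.lreg x <-> (forall y, y * x = 0 -> y = 0).
Proof.
split=> [xreg y yx|xreg y z /eqP]; first by apply: xreg; rewrite mulr0 mulrC.
by rewrite -subr_eq0 -mulrBr mulrC => /eqP/xreg/eqP; rewrite subr_eq0 => /eqP.
Qed.

Lemma faithful_ideal (T : Type) (x : T -> A) c :
  GRing.lreg c -> ideal_gen (fun y => exists i, y = x i) c -> faithful x.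
Proof.
move=> /lreg_annP creg [t [a [g [gx cE]]]] y yx.
apply: creg; rewrite cE mulr_sumr big1 // => i _.
by case: (gx i) => j ->; rewrite mulrCA yx mulr0.
Qed.

Section AnnihilatorPrime.
Variables (z : A) (z_neq0 : z != 0).
Hypothesis zP : forall x y, x * y * z = 0 -> x * z = 0 \/ y * z = 0.

Definition ann_pred : A -> bool := fun x => x * z == 0.

Fact ann_pred_closed : idealr_closed ann_pred.
Proof.
have inE' x : (x \in ann_pred) = (x * z == 0) by [].
split=> [||c x y]; rewrite !inE' ?mul0r ?mul1r // => /eqP xz /eqP yz.
by rewrite mulrDl -mulrA xz yz mulr0 addr0.
Qed.

HB.instance Definition _ := isIdealr.Build A ann_pred ann_pred_closed.

Fact ann_pred_prime : prime_idealr_closed ann_pred.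
Proof.
move=> x y; rewrite !unfold_in => /eqP /zP[] ->; rewrite eqxx // orbT //.
Qed.

HB.instance Definition _ := isPrimeIdealrClosed.Build A ann_pred ann_pred_prime.

Definition ann_prime : prime_idealr A := ann_pred.

Lemma in_ann_prime x : (x \in ann_prime) = (x * z == 0).
Proof. by []. Qed.

End AnnihilatorPrime.

Hypothesis redA : reduced A.

Lemma reduced_mulX y x e : y * x ^+ e = 0 -> y * x = 0.
Proof.
case: e => [|e]; first by rewrite expr0 mulr1 => ->; rewrite mul0r.
move=> yx; apply: (redA (e := e.+1)).
by rewrite exprMn exprSr -mulrA yx mulr0.
Qed.

Lemma reduced_sqr x : x * x = 0 -> x = 0.
Proof. by rewrite -expr2; apply: redA. Qed.

Lemma reduced_mul_sqr y x : y * (x * x) = 0 -> y * x = 0.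
Proof. by rewrite -expr2; apply: reduced_mulX. Qed.

Hypothesis noeA : noetherian A.

(* A maximal annihilator among those of the nonzero multiples of y is prime. *)
Lemma exists_minimal_prime y : y != 0 ->
  exists2 P : prime_idealr A, minimal_prime P /\ y \notin P &
    exists2 z, z != 0 & forall x, (x \in P) = (x * z == 0).
Proof.
move=> y0; pose T := {c | c * y != 0}.
have t0 : T by exists 1; rewrite mul1r.
have [[c cy] cmax] := noetherian_max t0 noeA
  (fun t : T => annihilator_ideal (sval t * y)).
rewrite /= in cmax; set z := c * y in cy cmax.
have zP x w : x * w * z = 0 -> x * z = 0 \/ w * z = 0.
  move=> xwz; case: (eqVneq (w * z) 0) => [|wz]; [by right|left].
  have wcy : w * c * y != 0 by rewrite -mulrA.
  change (annihilator z x); apply: (cmax (exist (fun c => c * y != 0) _ wcy)) => [v|];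
    rewrite /annihilator /= -/z -!mulrA -/z.
    by move=> vz; rewrite mulrCA vz mulr0.
  by rewrite mulrA.
exists (ann_prime cy zP); last by exists z.
split=> [Q QP x|].
  rewrite in_ann_prime => /eqP xz.
  have : x * z \in Q by rewrite xz rpred0.
  rewrite prime_idealrM => /orP[//|/QP]; rewrite in_ann_prime.
  by move=> /eqP/reduced_sqr z0; move: (cy); rewrite z0 // eqxx.
rewrite in_ann_prime; apply/negP => /eqP yz.
by case/eqP: (cy); apply: reduced_sqr; rewrite /z -mulrA yz mulr0.
Qed.

(* Take z outside P with ann z maximal: a minimal prime Q = ann (c z) with z not in Q
   lies in P, as t in Q outside P would give c in ann (t z) = ann z. *)
Lemma minimal_prime_ann (P : prime_idealr A) : minimal_prime P ->
  exists2 z, z != 0 & forall x, (x \in P) = (x * z == 0).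
Proof.
move=> minP; pose T := {c | c \notin P}.
have t0 : T by exists 1; rewrite idealr1.
have [[z zP] zmax] := noetherian_max t0 noeA
  (fun t : T => annihilator_ideal (sval t)).
rewrite /= in zmax.
have z0 : z != 0 by apply: contraNneq (zP) => ->; rewrite rpred0.
have [Q [minQ zQ] [w w0 QE]] := exists_minimal_prime z0.
suff QP : {subset Q <= P}.
  exists w => // x; rewrite -QE; apply/idP/idP; first exact: minP.
  exact: QP.
move=> t tQ; apply/negPn/negP => tP.
have tzP : t * z \notin P by rewrite prime_idealrM negb_or tP.
have wz : w * z != 0 by rewrite mulrC -QE.
have : annihilator z w.
  apply: (zmax (exist (fun c => c \notin P) _ tzP)) => [x|]; rewrite /annihilator /=.
    by move=> xz; rewrite mulrCA xz mulr0.
  by rewrite mulrA [w * t]mulrC; move: tQ; rewrite QE => /eqP ->; rewrite mul0r.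
by move/eqP; rewrite (negPf wz).
Qed.

Lemma notin_minimal_prime (P : prime_idealr A) x :
  minimal_prime P -> GRing.lreg x -> x \notin P.
Proof.
move=> /minimal_prime_ann[z z0 ->] /lreg_annP xreg.
by apply: contraNneq z0; rewrite mulrC => /xreg ->.
Qed.

(** Minimal primes are annihilators of nonzero elements, and every nonzero element is missed by some
    minimal prime. This translates condition (2) of a rational datum. *)
Lemma faithful_minimal_primeP (T : Type) (x : T -> A) :
  faithful x <->
  (forall P : prime_idealr A, minimal_prime P -> exists j, x j \notin P).
Proof.
split=> [xF P /minimal_prime_ann[z z0 PE]|xP y yx].
  apply: NNPP => nx; move: z0; rewrite (xF z) ?eqxx // => i.
  apply/eqP; rewrite mulrC -PE; apply/negPn/negP => xiP.
  by apply: nx; exists i.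
apply/eqP/negPn/negP => /exists_minimal_prime[P [minP yP] _].
have [j xjP] := xP _ minP.
have : y * x j \in P by rewrite yx rpred0.
by rewrite prime_idealrM (negPf yP) (negPf xjP).
Qed.

End Annihilators.

(** * Reduced graded rings *)

Record grading (A : comNzRingType) (H : nat -> A -> Prop) : Prop := Grading {
  grad0 : forall d, H d 0;
  gradD : forall d x y, H d x -> H d y -> H d (x + y);
  gradN : forall d x, H d x -> H d (- x);
  gradM : forall d e x y, H d x -> H e y -> H (d + e)%N (x * y);
  grad1 : H 0%N 1;
  gradP : forall x, exists N (c : nat -> A),
            (forall i, H i (c i)) /\ x = \sum_(i < N) c i;
  grad_free : forall N (c : nat -> A), (forall i, H i (c i)) ->
            \sum_(i < N) c i = 0 -> forall i, (i < N)%N -> c i = 0 }.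

Section Graded.
Variables (A : comNzRingType) (H : nat -> A -> Prop).
Hypotheses (grH : grading H) (redA : reduced A).
Implicit Types (x y z : A).

Lemma grad_sum d (T : finType) (F : T -> A) (p : pred T) :
  (forall i, p i -> H d (F i)) -> H d (\sum_(i | p i) F i).
Proof.
by move=> HF; elim/big_rec: _ => [|i x pi Hx]; [apply: grad0|apply: gradD; auto].
Qed.

Lemma gradX d x e : H d x -> H (d * e)%N (x ^+ e).
Proof.
move=> Hx; elim: e => [|e IHe]; first by rewrite muln0; apply: grad1.
by rewrite mulnS exprS; apply: gradM.
Qed.

(* In the lexicographically least failing pair of indices with i + j = s, multiply
   the coefficient of degree s by p`_i: the terms before i vanish by minimality,
   and p`_i kills q`_l for l < j. *)
Lemma reduced_armendariz (p q : {poly A}) i j : p * q = 0 -> p`_i * q`_j = 0.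
Proof.
move=> pq; have [s ijs] : exists s, (i + j)%N = s by eexists.
elim/ltn_ind: s i j ijs => s IHs; elim/ltn_ind => i IHi j ijs.
rewrite mulrC; apply: (reduced_mul_sqr redA).
have := congr1 (fun r : {poly A} => p`_i * r`_s) pq.
have lt_is : (i < s.+1)%N by rewrite ltnS -ijs leq_addr.
rewrite /= coefM coef0 mulr0 (bigD1 (Ordinal lt_is)) //= mulrDr [X in _ + X]mulr_sumr.
rewrite big1 ?addr0 => [|l]; first by rewrite -ijs addKn mulrA mulrC.
rewrite -(inj_eq val_inj) /= neq_ltn => /orP[lt_li|lt_il].
  by rewrite IHi ?mulr0 //; move: (ltn_ord l); lia.
by rewrite mulrCA (IHs (i + (s - l))%N) ?mulr0 //; move: (ltn_ord l); lia.
Qed.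

(** Marking degrees by a variable T reduces this to polynomials: the coefficients of the product of
    sum c_i T^i and sum b_j T^j are the homogeneous components of a product that is 0, so they
    vanish. *)
Lemma graded_armendariz M N (c b : nat -> A) :
  (forall i, H i (c i)) -> (forall i, H i (b i)) ->
  (\sum_(i < M) c i) * (\sum_(j < N) b j) = 0 ->
  forall i j, (i < M)%N -> (j < N)%N -> c i * b j = 0.
Proof.
move=> Hc Hb cb i j ltiM ltjN.
pose p := \poly_(i < M) c i; pose q := \poly_(j < N) b j.
have Hp l : H l p`_l by rewrite coef_poly; case: ifP => _ //; apply: grad0.
have Hq l : H l q`_l by rewrite coef_poly; case: ifP => _ //; apply: grad0.
have Hpq l : H l (p * q)`_l.
  rewrite coefM; apply: grad_sum => s _.
  by rewrite -{1}(subnKC (ltnSE (ltn_ord s))); apply: gradM.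
have pq0 : p * q = 0.
  apply/polyP => l; rewrite coef0; case: (ltnP l (size (p * q))) => [ltl|lel].
    apply: (grad_free grH) Hpq _ _ ltl; transitivity ((p * q).[1]).
      by rewrite horner_coef; apply: eq_bigr => s _; rewrite expr1n mulr1.
    rewrite hornerM !horner_poly -[RHS]cb.
    by congr (_ * _); apply: eq_bigr => s _; rewrite expr1n mulr1.
  by rewrite nth_default.
by have := reduced_armendariz i j pq0; rewrite !coef_poly ltiM ltjN.
Qed.

Definition component (x : A) d (y : A) : Prop :=
  exists N (c : nat -> A),
    [/\ forall i, H i (c i), x = \sum_(i < N) c i, (d < N)%N & y = c d].

Lemma component_homog x d y : component x d y -> H d y.
Proof. by case=> N [c [Hc _ _ ->]]. Qed.

Lemma component_mul0 x d y z e w :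
  component x d y -> component z e w -> x * z = 0 -> y * w = 0.
Proof.
move=> [M [c [Hc -> dM ->]]] [N [b [Hb -> eN ->]]] cb.
exact: graded_armendariz cb _ _ dM eN.
Qed.

Lemma component_mul x z :
  (forall d y, component x d y -> y * z = 0) -> x * z = 0.
Proof.
have [N [c [Hc xE]]] := gradP grH x => xz.
rewrite xE mulr_suml big1 // => i _; apply: (xz i).
by exists N, c; split.
Qed.

Lemma component_neq0 x : x != 0 -> exists d y, component x d y /\ y != 0.
Proof.
move=> x0; apply: NNPP => nx; case/eqP: x0; rewrite -[x]mulr1.
apply: component_mul => d y xy; rewrite mulr1.
by apply/eqP/negPn/negP => y0; apply: nx; exists d, y.
Qed.

Lemma homog_component d x : H d x -> component x d x.
Proof.
move=> Hx; exists d.+1, (fun i => if i == d then x else 0); split=> // [i||].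
- by case: eqP => [->|_] //; apply: grad0.
- rewrite (bigD1 ord_max) //= eqxx big1 ?addr0 // => i.
  by rewrite -(inj_eq val_inj) /= => /negPf ->.
by rewrite eqxx.
Qed.

Hypothesis noeA : noetherian A.

Section Avoidance.
Variables (T : finType) (b : T -> A) (deg : T -> nat).
Hypotheses (deg_gt0 : forall i, (0 < deg i)%N) (Hb : forall i, H (deg i) (b i)).

(** The vanishing mutual products let multiplication by [m j] isolate the [j]-th term of a
    combination; the construction of homogeneous null vectors relies on this. *)
Definition orthogonal_multipliers (D : nat) (m : T -> A) : Prop :=
  [/\ (0 < D)%N, forall i, (deg i <= D)%N, forall i, H (D - deg i)%N (m i) &
      forall i j, i != j -> m i * m j = 0].

(* If a homogeneous c != 0 kills u = \sum_i m_i b_i, then c b_i != 0 for some i,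
   and u ^+ s + (c b_i) ^+ t has a smaller annihilator than u. *)
Lemma homogeneous_avoidance : faithful b ->
  exists D m, orthogonal_multipliers D m /\ GRing.lreg (\sum_i m i * b i).
Proof.
move=> bF; pose S := {Dm : nat * (T -> A) | orthogonal_multipliers Dm.1 Dm.2}.
have s0 : S.
  exists ((\sum_i deg i).+1, fun=> 0); split=> // [i|i|i j _]; last by rewrite mulr0.
    by rewrite (bigD1 i) //= -addnS leq_addr.
  exact: grad0.
pose u (s : S) := \sum_i (sval s).2 i * b i.
(* The double annihilator of [u s] grows when the annihilator of [u s] shrinks, so a maximal one
   comes from a minimal annihilator. *)
pose I s x := forall y, y * u s = 0 -> x * y = 0.
have idI s : is_ideal (I s).
  split=> [y _|c x y Ix Iy z zu]; first by rewrite mul0r.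
  by rewrite mulrDl -mulrA Ix // Iy // mulr0 addr0.
have [[[D m] /[dup] [[D0 degD Hm mm]] Dm] smax] := noetherian_max s0 noeA idI.
exists D, m; split=> //; apply/lreg_annP => y yu.
set s : S := exist _ _ _ in smax; rewrite -/(u s) in yu *.
have Hu : H D (u s).
  by apply: grad_sum => i _; rewrite -[D](subnK (degD i)); apply: gradM.
apply/eqP/negPn/negP => /component_neq0[e [c [yc c0]]].
have cu : c * u s = 0 by apply: component_mul0 yc (homog_component Hu) yu.
have Hc : H e c := component_homog yc.
have [i cbi] : exists i, c * b i != 0.
  apply: NNPP => nb; case/eqP: c0; apply: bF => i.
  by apply/eqP/negPn/negP => cb; apply: nb; exists i.
pose E := (e + deg i)%N; have HE : H E (c * b i) by apply: gradM.
have E0 : (0 < E)%N by rewrite addn_gt0 deg_gt0 orbT.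
(* With [u s] of degree D and [c * b i] of degree E, the powers 2E and 2D bring both to degree 2DE.
   The factor 2 keeps the exponent 2E - 1 positive with room to spare, so each cross term contains
   [u s * c], which is 0. *)
pose m' j :=
  u s ^+ (2 * E).-1 * m j + (if j == i then (c * b i) ^+ (2 * D).-1 * c else 0).
have u1 : u s ^+ (2 * E).-1 * c = 0.
  have -> : (2 * E).-1 = (2 * E).-2.+1 by lia.
  by rewrite exprSr -mulrA [u s * c]mulrC cu mulr0.
have Dm' : orthogonal_multipliers (2 * D * E)%N m'.
  split=> [|j|j|j l jl]; first by rewrite !muln_gt0 D0 E0.
  - by apply: leq_trans (degD j) _; rewrite mulnAC leq_pmull // muln_gt0 E0.
  - apply: gradD => //.
      have -> : (2 * D * E - deg j = D * (2 * E).-1 + (D - deg j))%N.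
        have -> : (2 * D * E = D * (2 * E).-1 + D)%N.
          by rewrite -mulnSr prednK ?muln_gt0 ?E0 // mulnCA mulnA.
        by rewrite addnBA.
      by apply: gradM => //; apply: gradX.
    case: eqP => [->|_]; last exact: grad0.
    have -> : (2 * D * E - deg i = E * (2 * D).-1 + e)%N.
      have -> : (2 * D * E = E * (2 * D).-1 + E)%N.
        by rewrite -mulnSr prednK ?muln_gt0 ?D0 // mulnC.
      by rewrite -addnBA ?leq_addl // addnK.
    by apply: gradM => //; apply: gradX.
  rewrite /m' mulrDl !mulrDr.
  rewrite mulrACA mm // mulr0 add0r.
  have -> : (if j == i then (c * b i) ^+ (2 * D).-1 * c else 0) *
     (if l == i then (c * b i) ^+ (2 * D).-1 * c else 0) = 0.
    case: (eqVneq j i) => [ji|]; last by rewrite mul0r.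
    by case: (eqVneq l i) jl => [->|]; rewrite ?mulr0 // ji eqxx.
  rewrite addr0; set v := u s ^+ _.
  have vc w x : v * w * (x * c) = 0.
    have -> : v * w * (x * c) = v * c * (w * x) by ring.
    by rewrite [v * c]u1 mul0r.
  case: ifP => _; rewrite ?mulr0 ?add0r ?mulr0 ?mul0r //; first rewrite vc.
    by case: ifP => _; rewrite ?add0r ?mul0r // mulrC vc.
  by case: ifP => _; rewrite ?add0r ?mul0r // mulrC vc.
pose s' : S := exist _ (_, m') Dm'.
have us' : u s' = u s ^+ (2 * E) + (c * b i) ^+ (2 * D).
  rewrite /u /= /m'; under eq_bigr do rewrite mulrDl -mulrA.
  rewrite big_split /= -mulr_sumr -/(u s) -exprSr prednK ?muln_gt0 ?E0 //.
  congr (_ + _); rewrite (bigD1 i) //= eqxx big1 ?addr0 => [|j /negPf ->]; last first.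
    by rewrite mul0r.
  by rewrite -mulrA -exprSr prednK // muln_gt0 D0.
have ann' x : x * u s' = 0 -> x * u s = 0 /\ x * (c * b i) = 0.
  rewrite us' => xu'; have xu : x * u s = 0.
    apply: (reduced_mulX redA (e := (2 * E).+1)).
    have := congr1 (fun w => w * u s) xu'; rewrite mul0r mulrDr mulrDl.
    have -> : x * (c * b i) ^+ (2 * D) * u s = 0.
      rewrite -[(2 * D)%N]prednK ?muln_gt0 ?D0 // exprS.
      set w := (c * b i) ^+ _.
      have -> : x * (c * b i * w) * u s = c * u s * (x * b i * w).
        by ring.
      by rewrite cu mul0r.
    by rewrite addr0 exprSr mulrA.
  split=> //; apply: (reduced_mulX redA (e := (2 * D)%N)).
  have -> : x * (c * b i) ^+ (2 * D) = 0 => //.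
  rewrite -[RHS]xu' mulrDr -[(2 * E)%N]prednK ?muln_gt0 ?E0 // exprS mulrA xu mul0r.
  by rewrite add0r.
have Iu s1 : I s1 (u s1) by move=> z zu; rewrite mulrC.
have Is' : I s' (c * b i) by move=> z /ann'[_]; rewrite mulrC.
(* By maximality [c * b i] lies in the double annihilator of [u s]. As [c] kills [u s], this gives c
   b_i c = 0, hence (c b_i)^2 = 0. *)
have : I s (c * b i).
  apply: (smax s') => // x Ix z /ann'[zu _]; exact: Ix.
move/(_ c cu) => cbc; case/eqP: cbi.
apply: (reduced_sqr redA); by rewrite mulrA cbc mul0r.
Qed.

End Avoidance.

End Graded.

(** * Minors *)

Section Minors.
Variable A : comNzRingType.

(** Multilinear expansion of the rows of the product. Summing over all maps, not just increasing
    ones, is the Cauchy-Binet formula before sorting, and suffices for annihilators of minors. *)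
Lemma det_mulmx_rows t p (C : 'M[A]_(t, p)) (M : 'M[A]_(p, t)) :
  \det (C *m M) =
  \sum_(f : {ffun 'I_t -> 'I_p}) (\prod_i C i (f i)) * \det (rowsub f M).
Proof.
rewrite /determinant; under [RHS]eq_bigr do rewrite mulr_sumr.
rewrite exchange_big /=; apply: eq_bigr => s _.
under eq_bigr do rewrite mxE; rewrite bigA_distr_bigA /= mulr_sumr.
apply: eq_bigr => f _; rewrite big_split /= mulrCA; congr (_ * (_ * _)).
by apply: eq_bigr => i _; rewrite mxE.
Qed.

Lemma minors_mulmx_eq0 t p q (C : 'M[A]_(t, p)) (M : 'M[A]_(p, q)) y :
  (forall (f : 'I_t -> 'I_p) (g : 'I_t -> 'I_q), y * \det (mxsub f g M) = 0) ->
  forall g : 'I_t -> 'I_q, y * \det (colsub g (C *m M)) = 0.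
Proof.
move=> yM g; have -> : colsub g (C *m M) = C *m colsub g M.
  by apply/matrixP => i j; rewrite !mxE; apply: eq_bigr => l _; rewrite !mxE.
rewrite det_mulmx_rows mulr_sumr big1 // => f _.
rewrite mulrCA; have -> : rowsub f (colsub g M) = mxsub f g M.
  by apply/matrixP => i j; rewrite !mxE.
by rewrite yM mulr0.
Qed.

Definition row_on_top n (v : 'I_n.+1 -> A) (N : 'M[A]_(n, n.+1)) : 'M[A]_n.+1 :=
  \matrix_(i, j) if unlift ord0 i is Some i' then N i' j else v j.

Lemma cofactor_row_on_top n (v : 'I_n.+1 -> A) N j :
  cofactor (row_on_top v N) ord0 j = signed_minor N j.
Proof.
rewrite /cofactor add0n; congr (_ * \det _).
by apply/matrixP => i l; rewrite !mxE liftK.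
Qed.

Lemma det_row_on_top n (v : 'I_n.+1 -> A) N :
  \det (row_on_top v N) = \sum_j v j * signed_minor N j.
Proof.
rewrite (expand_det_row _ ord0); apply: eq_bigr => j _.
by rewrite cofactor_row_on_top mxE unlift_none.
Qed.

(* Cramer's rule for the square matrix with the i-th unit row put on top of N. *)
Lemma signed_minor_null n (N : 'M[A]_(n, n.+1)) (w : 'cV[A]_n.+1) i j :
  N *m w = 0 -> signed_minor N i * w j 0 = w i 0 * signed_minor N j.
Proof.
move=> Nw; pose B := row_on_top (fun c => (c == i)%:R) N.
have detB : \det B = signed_minor N i.
  rewrite det_row_on_top (bigD1 i) //= eqxx mul1r big1 ?addr0 // => c /negPf ->.
  by rewrite mul0r.
have Bw : B *m w = \col_r (if r == ord0 then w i 0 else 0).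
  apply/colP => r; rewrite !mxE; case: (unliftP ord0 r) => [r' ->|->] /=.
    transitivity ((N *m w) r' 0); last by rewrite Nw mxE.
    by rewrite mxE; apply: eq_bigr => c _; rewrite mxE liftK.
  rewrite (bigD1 i) //= mxE unlift_none eqxx mul1r big1 ?addr0 // => c ci.
  by rewrite mxE unlift_none (negPf ci) mul0r.
have := congr1 (fun M : 'cV_n.+1 => M j 0) (mulmxA (\adj B) B w).
rewrite mul_adj_mx mul_scalar_mx detB Bw !mxE => <-.
rewrite (bigD1 ord0) //= !mxE eqxx big1 ?addr0 => [|c /negPf c0].
  by rewrite cofactor_row_on_top mulrC.
by rewrite [X in _ * X]mxE c0 mulr0.
Qed.

(** With D_i the signed minors, D_l v_i = v_l D_i and likewise for [w], so both products become v_l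
    w_l D_i D_j. *)
Lemma null_vectors_proportional n (N : 'M[A]_(n, n.+1)) (v w : 'cV[A]_n.+1) i j l :
  N *m v = 0 -> N *m w = 0 ->
  signed_minor N l * signed_minor N l * (v i 0 * w j 0 - v j 0 * w i 0) = 0.
Proof.
move=> Nv Nw; rewrite mulrBr (mulrACA _ _ (v i 0)) (mulrACA _ _ (v j 0)).
rewrite (signed_minor_null l i Nv) (signed_minor_null l j Nv).
rewrite (signed_minor_null l i Nw) (signed_minor_null l j Nw).
by rewrite mulrACA [X in _ - X]mulrACA [X in _ - _ * X]mulrC subrr.
Qed.

Lemma det_mxsub_ninj t p q (M : 'M[A]_(p, q)) (f : 'I_t -> 'I_p) (g : 'I_t -> 'I_q) :
  ~ injective f \/ ~ injective g -> \det (mxsub f g M) = 0.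
Proof.
have nex (r : nat) (h : 'I_t -> 'I_r) : ~ injective h -> exists i j, i != j /\ h i = h j.
  move/injectiveP/injectivePn=> [i [j ij hij]]; by exists i, j.
case=> /nex[i [j [ij hij]]].
  by apply: (determinant_alternate ij) => c; rewrite !mxE hij.
rewrite -det_tr; apply: (determinant_alternate ij) => c.
by rewrite !mxE hij.
Qed.

(** An injective [g] misses exactly one column [l] and equals [lift l] up to a permutation; for any
    other [g] the minor is 0. *)
Lemma minor_signed_minor n p (M : 'M[A]_(p, n.+1)) (f : 'I_n -> 'I_p)
    (g : 'I_n -> 'I_n.+1) :
  exists l c, \det (mxsub f g M) = c * signed_minor (rowsub f M) l.
Proof.
have [/injectiveP g_inj|] := boolP (injectiveb g); last first.
  move=> /injectiveP g_ninj; exists ord0, 0.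
  by rewrite mul0r det_mxsub_ninj //; right.
have [l gl] : exists l, l \notin codom g.
  apply/existsP; rewrite -negb_forall; apply/negP => /forallP gS.
  have := @leq_image_card _ _ g predT; rewrite card_ord.
  have -> : #|image g predT| = n.+1.
    by rewrite -[RHS]card_ord; apply: eq_card => i; rewrite gS.
  by rewrite ltnn.
have gneq i : l != g i by apply: contraNneq gl => ->; apply: codom_f.
(* The default is never reached, since [l] is not a value of [g]. *)
pose s i := odflt i (unlift l (g i)).
have gE i : g i = lift l (s i).
  by rewrite /s; case: unliftP (gneq i) => [j ->|->] //=; rewrite eqxx.
have s_inj : injective s by move=> i j sij; apply: g_inj; rewrite !gE sij.
exists l, ((-1) ^+ perm s_inj * (-1) ^+ l).
rewrite /signed_minor -mulrA [X in _ = _ * X]mulrA -expr2 sqrr_sign mul1r.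
have -> : mxsub f g M = col_perm (perm s_inj) (col' l (rowsub f M)).
  by apply/matrixP => i j; rewrite !mxE permE gE.
by rewrite col_permE det_mulmx det_perm odd_permV mulrC.
Qed.

(** Distinct columns force t = n + 1 and a bijective [g]. Multiplying by the adjugate then shows
    that the determinant kills every [x j]. *)
Lemma minors_gt_eq0 p n t (M : 'M[A]_(p, n.+1)) (x : 'I_n.+1 -> A)
    (f : 'I_t -> 'I_p) (g : 'I_t -> 'I_n.+1) :
  faithful x -> (forall r, \sum_j M r j * x j = 0) -> (n < t)%N ->
  \det (mxsub f g M) = 0.
Proof.
move=> xF Mx ltnt; have [/injectiveP g_inj|] := boolP (injectiveb g); last first.
  by move=> /injectiveP g_ninj; apply: det_mxsub_ninj; right.
have ct : t = n.+1.
  by apply/eqP; rewrite eqn_leq ltnt andbT -[t]card_ord -[n.+1]card_ord (leq_card g g_inj).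
have gB : bijective g by apply: (inj_card_bij g_inj); rewrite !card_ord ct.
have [h hK gK] := gB.
pose N := mxsub f g M; pose w : 'cV_t := \col_c x (g c).
have Nw : N *m w = 0.
  apply/colP => r; rewrite !mxE -[RHS](Mx (f r)) [RHS](reindex g); last exact: onW_bij.
  by apply: eq_bigr => c _; rewrite !mxE.
apply: xF => j; rewrite -[j]gK.
have := congr1 (fun M : 'cV_t => M (h j) 0) (mulmxA (\adj N) N w).
by rewrite mul_adj_mx mul_scalar_mx Nw mulmx0 !mxE.
Qed.

End Minors.

(** * Forms and the inclusion of k[f] in R *)

Section Forms.
Variable k : fieldType.

Lemma dhomog_bigprod n (T : finType) (F : T -> {mpoly k[n]}) (e : T -> nat) :
  (forall i, F i \is (e i).-homog) -> \prod_i F i \is (\sum_i e i)%N.-homog.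
Proof.
move=> HF; apply: (big_ind2 (fun (p : {mpoly k[n]}) d => p \is d.-homog)) => //.
  exact: dhomog1.
by move=> p d q e'; apply: dhomogM.
Qed.

Lemma mmap_scale (B : comNzRingType) (c : {rmorphism k -> B}) n (w : 'I_n -> B) F t q :
  q \is t.-homog -> mmap c (fun i => F * w i) q = F ^+ t * mmap c w q.
Proof.
move=> /dhomogP qt; rewrite /mmap mulr_sumr; apply: eq_big_seq => m /qt mt.
rewrite mulrCA; congr (_ * _); rewrite /mmap1 -mt /= mdegE expr_sum -big_split /=.
by apply: eq_bigr => i _; rewrite exprMn.
Qed.

Section Subst.
Variables (n m : nat) (f : 'I_m -> {mpoly k[n]}).

HB.instance Definition _ :=
  GRing.RMorphism.copy (@subst k n m f) (comp_mpoly [tuple f j | j < m]).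

Lemma substU i : subst f 'X_i = f i.
Proof. by rewrite /subst comp_mpolyXU -tnth_nth tnth_mktuple. Qed.

Lemma rmorph_subst (B : comNzRingType) (h : {rmorphism {mpoly k[n]} -> B}) q :
  h (subst f q) = mmap (h \o @mpolyC n k) (h \o f) q.
Proof.
rewrite /subst /comp_mpoly /mmap rmorph_sum; apply: eq_bigr => u _.
rewrite rmorphM /mmap1 rmorph_prod; congr (_ * _); apply: eq_bigr => i _.
by rewrite rmorphXn /= tnth_mktuple.
Qed.

Lemma dhomog_subst d e q :
  (forall j, f j \is d.-homog) -> q \is e.-homog -> subst f q \is (d * e)%N.-homog.
Proof.
move=> fd /dhomogP qe; rewrite /subst comp_mpolyE big_seq; apply: rpred_sum => u /qe ue.
apply: rpredZ; rewrite -ue /= mdegE big_distrr /=; apply: dhomog_bigprod => i.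
by rewrite tnth_mktuple; apply: dhomogMn.
Qed.

Lemma pihomog_subst d e q : (0 < d)%N -> (forall j, f j \is d.-homog) ->
  pihomog mdeg (d * e) (subst f q) = subst f (pihomog mdeg e q).
Proof.
move=> d0 fd; pose N := maxn (msize q) e.+1.
have -> : subst f q = \sum_(i < N) subst f (pihomog mdeg i q).
  by rewrite -rmorph_sum -pihomog_partitionE // leq_maxl.
rewrite raddf_sum /= (bigD1 (Ordinal (leq_maxr (msize q) e.+1))) //= big1 ?addr0.
  by rewrite pihomog_dE //; apply: dhomog_subst => //; apply: pihomogP.
move=> i; rewrite -(inj_eq val_inj) /= => ie.
apply: (@pihomog_ne0 _ _ _ (d * i)%N).
  by rewrite eqn_pmul2l.
by apply: dhomog_subst => //; apply: pihomogP.
Qed.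

End Subst.

Lemma subst_comp n m l (f : 'I_m -> {mpoly k[n]}) (g : 'I_l -> {mpoly k[m]}) q :
  subst f (subst g q) = subst (fun i => subst f (g i)) q.
Proof.
rewrite [LHS](rmorph_subst g (subst f)) /subst /comp_mpoly /mmap.
apply: eq_bigr => u _; congr (_ * _).
  by rewrite /= /subst comp_mpolyC.
by apply: eq_bigr => i _; rewrite /= !tnth_mktuple.
Qed.

Lemma substX_id n (q : {mpoly k[n]}) : subst (fun i : 'I_n => 'X_i) q = q.
Proof.
rewrite /subst comp_mpolyE [RHS]mpolyE; apply: eq_bigr => u _.
by rewrite [in RHS]mpolyXE_id; congr (_ *: _); apply: eq_bigr => i _;
  rewrite tnth_mktuple.
Qed.

Section GradedQuotient.
Variables (n : nat) (I : idealr {mpoly k[n.+1]}).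
Hypothesis I_homog : homogeneous_ideal I.
Local Notation Q := {ideal_quot I}.

Lemma pi_eq0 p : (\pi_Q p == 0) = (p \in I).
Proof.
by rewrite -[p in RHS]subr0 Quotient.idealrBE -[0 in LHS](rmorph0 (\pi_Q)) .
Qed.

Lemma pi_idealP p : reflect (\pi_Q p = 0) (p \in I).
Proof. by rewrite -pi_eq0; apply: eqP. Qed.

Definition homog_res d (x : Q) : Prop := exists2 p, p \is d.-homog & x = \pi_Q p.

Lemma homog_res_grading : grading homog_res.
Proof.
split.
- by move=> d; exists 0; rewrite ?rmorph0 ?rpred0.
- by move=> d _ _ [p pd ->] [q qd ->]; exists (p + q); rewrite ?rmorphD ?rpredD.
- by move=> d _ [p pd ->]; exists (- p); rewrite ?rmorphN ?rpredN.
- move=> d e _ _ [p pd ->] [q qe ->]; exists (p * q); rewrite ?rmorphM //.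
  exact: dhomogM.
- by exists 1; rewrite ?rmorph1 // dhomog1.
- elim/quotW => p; exists (msize p), (fun i => \pi_Q (pihomog mdeg i p)); split.
    by move=> i; exists (pihomog mdeg i p) => //; apply: pihomogP.
  by rewrite -raddf_sum -pihomog_partitionE.
move=> N c Hc cs i ltiN.
have [p cp] : exists p : nat -> {mpoly k[n.+1]},
    forall i, p i \is i.-homog /\ c i = \pi_Q (p i).
  have H j : exists p, p \is j.-homog /\ c j = \pi_Q p by case: (Hc j) => p; exists p.
  exists (fun j => proj1_sig (constructive_indefinite_description _ (H j))) => j.
  exact: proj2_sig (constructive_indefinite_description _ (H j)).
rewrite (cp i).2; apply/pi_idealP; have : \sum_(j < N) p j \in I.
  apply/pi_idealP; rewrite raddf_sum -[RHS]cs; apply: eq_bigr => j _.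
  by rewrite (cp j).2.
move/I_homog => /(_ i); rewrite raddf_sum (bigD1 (Ordinal ltiN)) //= big1 ?addr0.
  by rewrite pihomog_dE // (cp i).1.
move=> j; rewrite -(inj_eq val_inj) /= => ji.
by apply: (@pihomog_ne0 _ _ _ j); rewrite ?(cp j).1.
Qed.

Lemma noetherian_quot : noetherian Q.
Proof.
apply: (@noetherian_surj {mpoly k[n.+1]} Q (\pi_Q)); last first.
  exact: noetherian_mpoly (@noetherian_field k).
by elim/quotW => p; exists p.
Qed.

End GradedQuotient.

Section Image.
Variables (n m d : nat) (a : idealr {mpoly k[n.+1]}).
Variable f : 'I_m.+1 -> {mpoly k[n.+1]}.
Local Notation R := {ideal_quot a}.
Local Notation S := {ideal_quot (image_ideal a f)}.

Lemma image_ideal_homogeneous : homogeneous_ideal a ->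
  (0 < d)%N -> (forall j, f j \is d.-homog) -> homogeneous_ideal (image_ideal a f).
Proof.
move=> a_homog d0 fd q e; rewrite !unfold_in => /(a_homog _ (d * e)%N).
by rewrite (pihomog_subst e q d0 fd).
Qed.

(** The choice of representative is harmless, and the map is injective, because [image_ideal a f] is
    the kernel of substituting [f] modulo [a]. *)
Definition image_incl (s : S) : R := \pi_R (subst f (repr s)).

Lemma image_incl_pi q : image_incl (\pi_S q) = \pi_R (subst f q).
Proof.
apply/eqP; rewrite -subr_eq0 -rmorphB -rmorphB pi_eq0.
suff : repr (\pi_S q) - q \in image_ideal a f by [].
by rewrite -pi_eq0 rmorphB /= reprK subrr.
Qed.

Fact image_incl_is_additive : zmod_morphism image_incl.
Proof.
elim/quotW => p; elim/quotW => q.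
by rewrite -rmorphB !image_incl_pi !rmorphB.
Qed.

HB.instance Definition _ :=
  GRing.isZmodMorphism.Build S R image_incl image_incl_is_additive.

Fact image_incl_is_multiplicative : monoid_morphism image_incl.
Proof.
split; first by rewrite -(rmorph1 (\pi_S)) image_incl_pi !rmorph1.
elim/quotW => p; elim/quotW => q.
by rewrite -rmorphM !image_incl_pi !rmorphM.
Qed.

HB.instance Definition _ :=
  GRing.isMonoidMorphism.Build S R image_incl image_incl_is_multiplicative.

Lemma image_incl_eq0 s : image_incl s = 0 -> s = 0.
Proof.
by elim/quotW: s => q; rewrite image_incl_pi => /pi_idealP q0; apply/pi_idealP.
Qed.

Lemma image_reduced : reduced R -> reduced S.
Proof.
move=> redR s e se; apply: image_incl_eq0; apply: (redR _ e).
by rewrite -rmorphXn se rmorph0.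
Qed.

End Image.
End Forms.

Lemma mulXn_polyC_eq0 (A : nzRingType) q (c : A) : 'X^q * c%:P = 0 -> c = 0.
Proof.
by move/(congr1 (fun r : {poly A} => r`_q)); rewrite coefXnM ltnn subnn coefC eqxx coef0.
Qed.

(** * The Jacobian dual matrix *)

Section HomogeneousCoefficients.
Variables (k : fieldType) (n : nat).
Implicit Type p : {mpoly k[n]}.

Lemma mcoeff_pihomog p d u :
  (pihomog mdeg d p)@_u = if mdeg u == d then p@_u else 0.
Proof.
case: eqP => [ud|/eqP ud]; last exact: dhomog_nemf_coeff (pihomogP mdeg d p) ud.
rewrite [in RHS](@pihomog_partitionE _ _ mdeg (maxn (msize p) d.+1) p) ?leq_maxl //.
rewrite [RHS]raddf_sum [RHS](bigD1 (Ordinal (leq_maxr (msize p) d.+1))) //=.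
rewrite [X in _ = _ + X]big1 ?addr0 // => i.
rewrite -(inj_eq val_inj) /= => id.
by apply: (dhomog_nemf_coeff (pihomogP mdeg i p)); rewrite /= ud eq_sym.
Qed.

Lemma dhomog0E p : p \is 0.-homog -> p = (p@_0)%:MP.
Proof.
move=> p0; apply/mpolyP => u; rewrite mcoeffC; case: eqP => [->|/eqP u0].
  by rewrite mulr1.
by rewrite mulr0; apply: (dhomog_nemf_coeff p0); rewrite /= mdeg_eq0.
Qed.

End HomogeneousCoefficients.

Section JacobianDual.
Variables (k : fieldType) (n m : nat) (a : idealr {mpoly k[n.+1]}).
Variable f : 'I_m.+1 -> {mpoly k[n.+1]}.
Local Notation R := {ideal_quot a}.
Local Notation S := {ideal_quot (image_ideal a f)}.
Local Notation kY := {mpoly k[m.+1]}.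
Local Notation kXY := {mpoly {mpoly k[n.+1]}[m.+1]}.
Local Notation x := (fun i : 'I_n.+1 => \pi_R ('X_i : {mpoly k[n.+1]})).
Local Notation ev q := (\pi_R (subst f q)).

(** The coefficient of X_i in the X-linear part of [P], as a polynomial in Y; its residue in S is
    [jac_entry]. *)
Definition xcoef (i : 'I_n.+1) (P : kXY) : kY :=
  map_mpoly (mcoeff 0%MM) (map_mpoly (mderiv i) P).

Definition liftY (v : kY) : kXY := map_mpoly (@mpolyC n.+1 k) v.

Definition const_part (P : kXY) : kY := map_mpoly (mcoeff 0%MM) P.

Lemma mcoeff_xcoef i P mu : (xcoef i P)@_mu = (P@_mu)@_(U_(i)).
Proof. by rewrite /xcoef !mcoeff_map_mpoly /= mcoeff_mderiv add0m mnm0E. Qed.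

Lemma xcoefD i : {morph xcoef i : P Q / P + Q}.
Proof. by move=> P Q; rewrite /xcoef !raddfD. Qed.

Lemma xcoefB i : {morph xcoef i : P Q / P - Q}.
Proof. by move=> P Q; rewrite /xcoef !raddfB. Qed.

Lemma xcoef0 i : xcoef i 0 = 0.
Proof. by rewrite /xcoef !raddf0. Qed.

Lemma xcoef_sum i (T : Type) (r : seq T) (p : pred T) (F : T -> kXY) :
  xcoef i (\sum_(t <- r | p t) F t) = \sum_(t <- r | p t) xcoef i (F t).
Proof. exact: (big_morph _ (xcoefD i) (xcoef0 i)). Qed.

Lemma xcoefC i (p : {mpoly k[n.+1]}) : xcoef i p%:MP = (p@_(U_(i)))%:MP.
Proof.
apply/mpolyP => mu; rewrite mcoeff_xcoef !mcoeffC.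
by case: eqP => _; rewrite ?mulr1 // !mulr0 mcoeff0.
Qed.

(** The Leibniz rule at X = 0. The last term vanishes when [Q] is linear in X, so X-linear parts of
    combinations have coefficients in k[Y]. *)
Lemma xcoefM i P Q :
  xcoef i (P * Q) = const_part P * xcoef i Q + xcoef i P * const_part Q.
Proof.
apply/mpolyP => mu; rewrite mcoeff_xcoef mcoeffD !mcoeffM raddf_sum -big_split /=.
apply: eq_bigr => u _; rewrite !mcoeff_xcoef !mcoeff_map_mpoly.
have E (p : {mpoly k[n.+1]}) : p@_U_(i) = (p^`M(i))@_0.
  by rewrite mcoeff_mderiv add0m mnm0E.
by rewrite !E mderivM mcoeffD !rmorphM addrC.
Qed.

Lemma linear_formE (p : {mpoly k[n.+1]}) :
  p \is 1.-homog -> p = \sum_i p@_(U_(i)) *: 'X_i.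
Proof.
move=> p1; apply/mpolyP => u; rewrite raddf_sum /=.
under eq_bigr do rewrite mcoeffZ mcoeffX.
have [/mdeg1P[i /eqP ->]|u1] := boolP (mdeg u == 1%N).
  rewrite (bigD1 i) //= eqxx mulr1 big1 ?addr0 // => j /negPf ji.
  by rewrite eq_mnm1 ji mulr0.
rewrite (dhomog_nemf_coeff p1 u1) big1 // => i _.
by case: eqP => [ui|]; rewrite ?mulr0 //; rewrite -ui mdeg1 in u1.
Qed.

Lemma bihomog1E q P : bihomog 1 q P ->
  P = \sum_i ('X_i)%:MP * liftY (xcoef i P).
Proof.
case=> _ P1; apply/mpolyP => mu; rewrite raddf_sum /= [LHS]linear_formE ?P1 //.
apply: eq_bigr => i _; rewrite mcoeffCM mcoeff_map_mpoly mcoeff_xcoef.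
by rewrite mulrC mul_mpolyC.
Qed.

Lemma xcoef_lin i j v : xcoef i (('X_j)%:MP * liftY v) = (j == i)%:R * v.
Proof.
apply/mpolyP => mu; rewrite mcoeff_xcoef mcoeffCM mcoeff_map_mpoly /= mulrC.
by rewrite mcoeffCM mcoeffXU -mulrC -mpolyC_nat mcoeffCM mulrC.
Qed.

Lemma xcoef_homog i q P : bihomog 1 q P -> xcoef i P \is q.-homog.
Proof.
case=> /dhomogP Pq _; apply/dhomogP => mu; rewrite mcoeff_msupp mcoeff_xcoef => Pmu.
by apply: Pq; rewrite mcoeff_msupp; apply: contra_neqN Pmu => /eqP ->; rewrite mcoeff0.
Qed.

Lemma const_part_bihomog q P : bihomog 1 q P -> const_part P = 0.
Proof.
case=> _ P1; apply/mpolyP => mu; rewrite mcoeff_map_mpoly mcoeff0.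
by apply: (dhomog_nemf_coeff (P1 mu)); rewrite /= mdeg0.
Qed.

Lemma bihomog_lin q (v : 'I_n.+1 -> kY) : (forall i, v i \is q.-homog) ->
  bihomog 1 q (\sum_i ('X_i)%:MP * liftY (v i)).
Proof.
move=> vq; have coefE mu : (\sum_i ('X_i)%:MP * liftY (v i))@_mu =
    \sum_i (v i)@_mu *: 'X_i :> {mpoly k[n.+1]}.
  rewrite raddf_sum; apply: eq_bigr => i _.
  by rewrite /= mcoeffCM mcoeff_map_mpoly /= mulrC mul_mpolyC.
split=> [|mu]; last first.
  by rewrite coefE; apply: rpred_sum => i _; apply: rpredZ; rewrite dhomogX /= mdeg1.
apply/dhomogP => mu; rewrite mcoeff_msupp coefE; apply: contraNeq => muq.
rewrite big1 // => i _; rewrite (dhomog_nemf_coeff (vq i)) ?scale0r //.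
Qed.

Definition linear_syzygy (v : 'I_n.+1 -> kY) : Prop := \sum_i x i * ev (v i) = 0.

Let rY (P : kXY) : {poly R} := rees_map f (resY a P).

Let rY_is_additive : zmod_morphism rY.
Proof. by move=> P Q; rewrite /rY /rees_map /resY !raddfB. Qed.

Let rY_is_multiplicative : monoid_morphism rY.
Proof.
by split=> [|P Q]; rewrite /rY /rees_map /resY ?rmorph1 // !rmorphM.
Qed.
HB.instance Definition _ :=
  GRing.isZmodMorphism.Build kXY {poly R} rY rY_is_additive.
HB.instance Definition _ :=
  GRing.isMonoidMorphism.Build kXY {poly R} rY rY_is_multiplicative.

Lemma mmap_eq (B : comNzRingType) (c c' : k -> B) l (w w' : 'I_l -> B) q :
  c =1 c' -> w =1 w' -> mmap c w q = mmap c' w' q.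
Proof.
move=> cc ww; apply: eq_bigr => u _; rewrite cc; congr (_ * _).
by apply: eq_bigr => i _; rewrite ww.
Qed.

(** A form of degree [q] evaluated at multiples of 'X yields the factor 'X^q. Cancelling it later
    turns membership in the Rees ideal into a relation in R. *)
Lemma rees_liftY q v : v \is q.-homog -> rY (liftY v) = 'X^q * (ev v)%:P.
Proof.
move=> vq; pose h : {rmorphism kY -> {poly R}} := rY \o map_mpoly (@mpolyC n.+1 k).
have -> : rY (liftY v) = h v by [].
rewrite -[in LHS](substX_id v) (rmorph_subst _ h).
have -> : (ev v)%:P =
    mmap (polyC \o \pi_R \o @mpolyC n.+1 k) (fun j => (\pi_R (f j))%:P) v.
  exact: (rmorph_subst f (polyC \o \pi_R : {rmorphism {mpoly k[n.+1]} -> {poly R}})).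
rewrite -mmap_scale //; apply: mmap_eq => [c|j].
  by rewrite /= /rY /resY /rees_map !map_mpolyC mmapC.
by rewrite /= /rY /resY /rees_map !map_mpolyX mmapX mmap1U -mul_polyC mulrC.
Qed.

Lemma rees_bihomog1 q P : bihomog 1 q P ->
  rY P = 'X^q * (\sum_i x i * ev (xcoef i P))%:P.
Proof.
move=> Pq; rewrite {1}(bihomog1E Pq) rmorph_sum /= rmorph_sum mulr_sumr /=.
apply: eq_bigr => i _; rewrite rmorphM /= (rees_liftY (xcoef_homog i Pq)) mulrCA.
by congr (_ * _); rewrite rmorphM; congr (_ * _);
  rewrite /rY /resY /rees_map map_mpolyC mmapC.
Qed.

Lemma rees_syzygyP q P : bihomog 1 q P ->
  rees_map f (resY a P) = 0 <-> linear_syzygy (fun i => xcoef i P).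
Proof.
move=> Pq; rewrite -/(rY P) (rees_bihomog1 Pq) /linear_syzygy.
split=> [|->]; last by rewrite mulr0.
exact: mulXn_polyC_eq0.
Qed.

End JacobianDual.

Lemma grad_det (A : comNzRingType) (H : nat -> A -> Prop) t
    (M : 'M[A]_t) (e : 'I_t -> nat) :
  grading H -> (forall i j, H (e i) (M i j)) -> H (\sum_i e i)%N (\det M).
Proof.
move=> grH HM; apply: (grad_sum grH) => s _.
have Hs : H 0%N ((-1) ^+ s).
  by case: (odd_perm s); rewrite ?expr1; [apply: gradN (grad1 grH)|exact: grad1].
rewrite -[(\sum_i _)%N]add0n; apply: gradM => //.
apply: (big_rec2 (fun e y => H e y)) => [|i d y _ Hy]; first exact: grad1.
exact: gradM.
Qed.

(** * Linear forms in the ideal and their number *)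

Section LinearPart.
Variables (k : fieldType) (n : nat) (a : idealr {mpoly k[n.+1]}).
Local Notation kX := {mpoly k[n.+1]}.

Definition linear_part_mx r (l : 'I_r -> kX) : 'M[k]_(r, n.+1) :=
  \matrix_(i, j) (l i)@_(U_(j)).

Lemma linear_part_mxP r (l : 'I_r -> kX) (u : 'rV[k]_r) (p : kX) :
  (forall i, l i \is 1.-homog) -> p \is 1.-homog ->
  (u *m linear_part_mx l = \row_j p@_(U_(j))) <-> (p = \sum_i u 0 i *: l i).
Proof.
move=> l1 p1; have sE j : (\sum_i u 0 i *: l i)@_(U_(j)) = (u *m linear_part_mx l) 0 j.
  by rewrite raddf_sum mxE; apply: eq_bigr => i _; rewrite /= mcoeffZ mxE.
split=> [ul|->]; last by apply/rowP => j; rewrite [RHS]mxE sE.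
rewrite [p]linear_formE // [RHS]linear_formE; last first.
  by apply: rpred_sum => i _; apply: rpredZ; apply: l1.
by apply: eq_bigr => j _; rewrite sE ul mxE.
Qed.

Lemma row_freeI r q (M : 'M[k]_(r, q)) :
  (forall u : 'rV_r, u *m M = 0 -> u = 0) -> row_free M.
Proof.
move=> Minj; rewrite -kermx_eq0; apply/eqP/row_matrixP => i; rewrite row0.
by apply: Minj; rewrite -row_mul mulmx_ker row0.
Qed.

Lemma linear_part_free r (l : 'I_r -> kX) :
  (forall i, l i \is 1.-homog) ->
  (forall c : 'I_r -> k, \sum_i c i *: l i = 0 -> forall i, c i = 0) ->
  row_free (linear_part_mx l).
Proof.
move=> l1 lfree; apply: row_freeI => u ul; apply/rowP => i; rewrite mxE.
apply: (lfree (fun i => u 0 i)); apply/esym/(linear_part_mxP _ l1); first exact: rpred0.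
by rewrite ul; apply/rowP => j; rewrite !mxE mcoeff0.
Qed.

(** The coefficient matrix of [l'] has full row rank and factors through that of [l]. *)
Lemma a1_basis_max r (l : 'I_r -> kX) t (l' : 'I_t -> kX) : a1_basis a l ->
  (forall i, l' i \is 1.-homog /\ l' i \in a) ->
  (forall c : 'I_t -> k, \sum_i c i *: l' i = 0 -> forall i, c i = 0) -> (t <= r)%N.
Proof.
move=> [l1 _ lspan] l'1 l'free.
have /eqP <- : row_free (linear_part_mx l').
  by apply: linear_part_free => // i; case: (l'1 i).
have [D DE] := fin_all_exists (fun i => lspan _ (l'1 i).1 (l'1 i).2).
have -> : linear_part_mx l' = (\matrix_(i, j) D i j) *m linear_part_mx l.
  apply/row_matrixP => i; rewrite row_mul.
  have /linear_part_mxP -> : l' i = \sum_j (row i (\matrix_(i, j) D i j)) 0 j *: l j.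
  - by rewrite [LHS]DE; apply: eq_bigr => j _; rewrite !mxE.
  - by apply/rowP => j; rewrite !mxE.
  - by move=> j; case: (l1 j).
  by case: (l'1 i).
by apply: leq_trans (mxrankM_maxr _ _) (rank_leq_row _).
Qed.

Lemma a1_basis_le r (l : 'I_r -> kX) : a1_basis a l -> (r <= n.+1)%N.
Proof.
case=> l1 lfree _; have /eqP <- : row_free (linear_part_mx l).
  by apply: linear_part_free => // i; case: (l1 i).
exact: rank_leq_col.
Qed.

(** Among matrices whose row space lies in a_1, one of greatest rank has row space equal to a_1, and
    [row_base] extracts a basis. Greatest rank is phrased as least n + 1 - rank. *)
Lemma exists_a1_basis : exists r (l : 'I_r -> kX), a1_basis a l.
Proof.
pose lin (v : 'rV[k]_n.+1) : kX := \sum_j v 0 j *: 'X_j.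
have lin1 v : lin v \is 1.-homog.
  by apply: rpred_sum => j _; apply: rpredZ; rewrite dhomogX /= mdeg1.
have linE p : p \is 1.-homog -> p = lin (\row_j p@_(U_(j))).
  by move=> p1; rewrite [LHS]linear_formE //; apply: eq_bigr => j _; rewrite mxE.
have linP c u v : lin (c *: u + v) = c *: lin u + lin v.
  rewrite /lin scaler_sumr -big_split; apply: eq_bigr => j _.
  by rewrite !mxE scalerDl scalerA.
have lin_sum t (u : 'rV_t) (N : 'M_(t, n.+1)) :
    lin (u *m N) = \sum_i u 0 i *: lin (row i N).
  rewrite /lin; under [RHS]eq_bigr do rewrite scaler_sumr.
  rewrite exchange_big; apply: eq_bigr => j _; rewrite mxE scaler_suml.
  by apply: eq_bigr => i _; rewrite scalerA mxE.
have linI v : lin v = 0 -> v = 0.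
  move=> v0; apply/rowP => j; rewrite mxE; have := congr1 (mcoeff U_(j)%MM) v0.
  rewrite mcoeff0 raddf_sum (bigD1 j) //= big1 ?addr0 => [|i /negPf ij].
    by rewrite mcoeffZ mcoeffXU eqxx mulr1.
  by rewrite mcoeffZ mcoeffXU ij mulr0.
pose inW (M : 'M[k]_n.+1) := forall v : 'rV_n.+1, (v <= M)%MS -> lin v \in a.
have [|r [M [WM rM]] rmin] := @nat_least
  (fun r => exists M, inW M /\ r = (n.+1 - \rank M)%N).
  exists n.+1, 0; split; last by rewrite mxrank0 subn0.
  move=> v; rewrite submx0 => /eqP ->; suff -> : lin 0 = 0 by exact: rpred0.
  by rewrite /lin big1 // => j _; rewrite mxE scale0r.
have WMmax v : lin v \in a -> (v <= M)%MS.
  move=> va; have WMv : inW (M + v)%MS.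
    move=> w /sub_addsmxP[[u1 u2] /= ->]; rewrite -[_ *m M]scale1r linP scale1r rpredD //.
      by apply: WM; apply: submxMl.
    rewrite lin_sum big_ord1 row_id -mul_mpolyC; exact: idealMr.
  have := rmin _ (ex_intro _ _ (conj WMv erefl)).
  rewrite rM => le_r; have := mxrank_leqif_sup (addsmxSl M v).
  move/geq_leqif; have := rank_leq_col (M + v)%MS; have := rank_leq_col M.
  move=> h1 h2; have -> : (\rank (M + v)%MS <= \rank M)%N by move: h1 h2 le_r; lia.
  by move/esym => /(submx_trans (addsmxSr M v)).
exists (\rank M), (fun i => lin (row i (row_base M))); split=> [i|c|p p1 pa].
- by split=> //; apply: WM; rewrite (submx_trans (row_sub _ _)) // eq_row_base.
- have -> : \sum_i c i *: lin (row i (row_base M)) = lin ((\row_i c i) *m row_base M).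
    by rewrite lin_sum; apply: eq_bigr => i _; rewrite mxE.
  move/linI/eqP; rewrite mulmx_free_eq0 ?row_base_free // => /eqP c0 i.
  by have := congr1 (fun v : 'rV_(\rank M) => v 0 i) c0; rewrite !mxE.
have : (\row_j p@_(U_(j)) <= row_base M)%MS.
  by rewrite eq_row_base; apply: WMmax; rewrite -linE.
case/submxP => D pD; exists (fun i => D 0 i).
by rewrite -lin_sum -pD; apply: linE.
Qed.

Lemma dgi_basis : exists l : 'I_(dgi a) -> kX, a1_basis a l.
Proof. exact: (epsilon_spec (inhabits 0%N) _ exists_a1_basis). Qed.

Lemma dgi_le : (dgi a <= n.+1)%N.
Proof. by have [l] := dgi_basis; apply: a1_basis_le. Qed.

(** Since edim + dgi = n + 1, the numerical condition says rank n, whatever the linear forms in [a]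
    are; [dgi_le] guards against truncated subtraction in [edim]. A component may contain more
    linear forms, but the target rank stays n. *)
Lemma jdrank_plusE m (f : 'I_m.+1 -> kX) :
  jdrank_plus_is a f ((edim a)%:Z - 1) <-> jdrank_is a f n.
Proof.
have := dgi_le; rewrite /edim => le_dgi; split=> [[rho jd E]|jd].
  by have rn : rho = n by [move: E le_dgi; lia]; rewrite rn in jd.
by exists n => //; move: le_dgi; lia.
Qed.

End LinearPart.

(** * Rows of the Jacobian dual matrix as syzygies of the variables *)

Section JacobianDualRows.
Variables (k : fieldType) (n m : nat) (a : idealr {mpoly k[n.+1]}).
Variable f : 'I_m.+1 -> {mpoly k[n.+1]}.
Hypothesis a_homog : homogeneous_ideal a.
Local Notation R := {ideal_quot a}.
Local Notation S := {ideal_quot (image_ideal a f)}.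
Local Notation kY := {mpoly k[m.+1]}.
Local Notation kXY := {mpoly {mpoly k[n.+1]}[m.+1]}.
Local Notation x := (fun i : 'I_n.+1 => \pi_R ('X_i : {mpoly k[n.+1]})).
Local Notation incl := (@image_incl k n m a f).

Lemma resY_surj (Q : {mpoly R[m.+1]}) : exists P, resY a P = Q.
Proof.
exists (\sum_(mu <- msupp Q) (repr Q@_mu) *: 'X_[mu]).
rewrite /resY raddf_sum [RHS]mpolyE; apply: eq_bigr => mu _ /=.
by rewrite map_mpolyZ map_mpolyX /= reprK.
Qed.

Lemma resY_eq0 (P : kXY) : resY a P = 0 -> forall mu, P@_mu \in a.
Proof.
move=> P0 mu; rewrite -pi_eq0; have := congr1 (mcoeff mu) P0.
by rewrite mcoeff_map_mpoly mcoeff0 => ->.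
Qed.

Lemma exists_jacobian_dual :
  exists r s (psi : 'M[S]_(r + s, n.+1)), jacobian_dual psi.
Proof.
have [r [l lB]] := exists_a1_basis a.
pose good s := exists g : 'I_s -> {mpoly R[m.+1]}, (forall i, J1 f (g i)) /\
  forall y, ideal_gen (J1 f) y -> ideal_gen (fun z => exists i, z = g i) y.
have [|s [g [gJ gS]] smin] := @nat_least good.
  have [s [g gP]] := noetherian_gens (J1 f)
    (noetherian_mpoly (n := m.+1) (noetherian_quot (I := a))).
  by exists s, g.
have [q qP] := fin_all_exists (fun i => (gJ i).2).
have [P Pq] := fin_all_exists qP.
exists r, s, (col_mx (\matrix_(i, j) jac_entry a f (l i)%:MP j)
                     (\matrix_(i, j) jac_entry a f (P i) j)).
have gE i : g i = resY a (P i) by case: (Pq i).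
exists l, P; split=> //; first by move=> i; exists (q i); case: (Pq i).
split=> [y|i irr].
  split; last by move/gS; apply: ideal_gen_mono => _ [i ->]; exists i.
  apply: ideal_gen_min; first exact: ideal_gen_ideal.
  by move=> _ [i ->]; apply: ideal_gen_sub; rewrite -gE.
case: s g gJ gS smin q qP P Pq gE i irr => [|s] g gJ gS smin q qP P Pq gE i irr.
  by case: (i).
have /smin : good s; last by rewrite ltnn.
exists (g \o lift i); split=> [j|y Jy]; first exact: gJ.
apply: ideal_gen_mono (irr y _) => [z|]; last exact: Jy.
case=> j ji ->; case: (unliftP i j) ji => [j' ->|->] // _.
by exists j'; rewrite /= gE.
Qed.

Lemma rees_ideal_J1 Q : ideal_gen (J1 (a := a) f) Q -> rees_map f Q = 0.
Proof.
apply: (@ideal_gen_min _ _ (fun Q => rees_map f Q = 0)) => [|Q' [] //].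
split=> [|c P P' P0 P0']; first by rewrite /rees_map rmorph0.
have -> : rees_map f (c * P + P') = rees_map f c * rees_map f P + rees_map f P'.
  by rewrite /rees_map rmorphD rmorphM.
by rewrite P0 P0' mulr0 addr0.
Qed.

Section Rows.
Variables (r s : nat) (psi : 'M[S]_(r + s, n.+1)).
Hypothesis jd : jacobian_dual psi.

Lemma jacobian_dual_syzygy i : \sum_j incl (psi i j) * x j = 0.
Proof.
case: jd => l [P [[l1 lfree lspan] P1 [PJ _] ->]].
have inclE Q j : incl (jac_entry a f Q j) = \pi_R (subst f (xcoef j Q)).
  by rewrite image_incl_pi.
case: (split_ordP i) => i' ->.
  under eq_bigr do rewrite col_mxEu mxE inclE.
  have [l1i /pi_idealP l0] := l1 i'; rewrite -[RHS]l0.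
  rewrite [in RHS](linear_formE l1i) raddf_sum; apply: eq_bigr => j _ /=.
  rewrite -mul_mpolyC rmorphM; congr (\pi_R _ * _).
  by rewrite xcoefC /subst comp_mpolyC.
under eq_bigr do rewrite col_mxEd mxE inclE.
have [q Pq] := P1 i'.
have := rees_ideal_J1 ((PJ _).1 (ideal_gen_sub (ex_intro _ i' erefl))).
move/(rees_syzygyP a f Pq) => syz; rewrite -[RHS]syz.
by apply: eq_bigr => j _; rewrite mulrC.
Qed.

(** The rows [l j] have degree 0. A [P i] of degree 0 in Y would be a linear form vanishing in R,
    hence a zero generator, against minimality. Part (ii) needs this positivity to obtain minors of
    positive degree. *)
Lemma jacobian_dual_lift : exists (e : 'I_(r + s) -> nat)
    (V : 'I_(r + s) -> 'I_n.+1 -> kY),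
  [/\ forall i j, V i j \is (e i).-homog, forall i j, psi i j = \pi_S (V i j) &
      forall i, (0 < e (rshift r i))%N].
Proof.
case: jd => l [P [[l1 lfree lspan] P1 [PJ Pmin] psiE]].
have [q Pq] := fin_all_exists P1.
exists (fun i => match split i with inl _ => 0%N | inr j => q j end).
exists (fun i c => xcoef c (match split i with inl j => (l j)%:MP | inr j => P j end)).
split=> [i j|i j|i].
- case: (split i) => i'; last exact: xcoef_homog.
  rewrite xcoefC.
  by rewrite -[_%:MP]mulr1 mul_mpolyC rpredZ // dhomog1.
- rewrite psiE; case: (split_ordP i) => i' ->.
    by rewrite col_mxEu mxE.
  by rewrite col_mxEd mxE.
rewrite -[rshift r i]/(unsplit (inr i)) unsplitK lt0n; apply/negP => /eqP q0.
apply: (Pmin i) => y /PJ; apply: ideal_gen_min; first exact: ideal_gen_ideal.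
move=> _ [j ->]; case: (eqVneq j i) => [->|/eqP ji]; last first.
  by apply: ideal_gen_sub; exists j.
have := rees_ideal_J1 ((PJ _).1 (ideal_gen_sub (ex_intro _ i erefl))).
move/(rees_syzygyP a f (Pq i)) => syz.
suff -> : resY a (P i) = 0 by apply: ideal_gen0.
rewrite {1}(bihomog1E (Pq i)) /resY rmorph_sum -[RHS](mpolyC0 m.+1) -syz raddf_sum.
apply: eq_bigr => c _ /=; rewrite !rmorphM /= map_mpolyC; congr (_ * _).
rewrite (dhomog0E (p := xcoef c (P i))); last by have := xcoef_homog c (Pq i); rewrite q0.
by rewrite /liftY !map_mpolyC /subst comp_mpolyC.
Qed.

(* The polynomial of bidegree (1, e) attached to v is a combination of the P_i modulo
   a; taking X-linear parts leaves a k[Y]-combination of the P_i and of the l_j. *)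
Lemma jacobian_dual_rowspan e (v : 'I_n.+1 -> kY) :
  (forall i, v i \is e.-homog) -> linear_syzygy a f v ->
  exists C : 'rV[S]_(r + s), forall i, \pi_S (v i) = (C *m psi) 0 i.
Proof.
case: jd => l [P [[l1 lfree lspan] P1 [PJ _] ->]] ve vsyz.
have [q Pq] := fin_all_exists P1.
pose Q : kXY := \sum_i ('X_i)%:MP * liftY n (v i).
have Qe : bihomog 1 e Q := bihomog_lin ve.
have vQ i : xcoef i Q = v i.
  rewrite /Q xcoef_sum; under eq_bigr do rewrite xcoef_lin.
  rewrite (bigD1 i) //= eqxx mul1r big1 ?addr0 // => j /negPf ->.
  by rewrite mul0r.
have JQ : ideal_gen (J1 f) (resY a Q).
  apply: ideal_gen_sub; split; last by exists e, Q.
  apply/(rees_syzygyP a f Qe); rewrite /linear_syzygy -[RHS]vsyz.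
  by apply: eq_bigr => i _; rewrite vQ.
have [c cE] := ideal_gen_range ((PJ _).2 JQ).
have [A AE] := fin_all_exists (fun i => resY_surj (c i)).
pose E := \sum_i A i * P i - Q.
have Ea mu : E@_mu \in a.
  apply: resY_eq0.
  have -> : resY a E = \sum_i resY a (A i) * resY a (P i) - resY a Q.
    rewrite /resY /E rmorphB rmorph_sum; congr (_ - _).
    by apply: eq_bigr => i _; rewrite rmorphM.
  apply/eqP; rewrite cE subr_eq0; apply/eqP; apply: eq_bigr => i _.
  by rewrite AE.
have Eb mu : exists b : 'I_r -> k, pihomog mdeg 1 E@_mu = \sum_i b i *: l i.
  by apply: lspan; [apply: pihomogP|apply: a_homog (Ea mu)].
have [b bE] : exists b : 'X_{1..m.+1} -> 'I_r -> k,
    forall mu, pihomog mdeg 1 E@_mu = \sum_i b mu i *: l i.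
  exists (fun mu => proj1_sig (constructive_indefinite_description _ (Eb mu))) => mu.
  exact: proj2_sig (constructive_indefinite_description _ (Eb mu)).
pose B j : kY := \sum_(mu <- msupp E) b mu j *: 'X_[mu].
have xE i : xcoef i E = \sum_j B j * ((l j)@_(U_(i)))%:MP.
  apply/mpolyP => mu; rewrite mcoeff_xcoef raddf_sum /=.
  under eq_bigr do rewrite mulrC mcoeffCM raddf_sum /= mulrC.
  have [mu_E|mu_E] := boolP (mu \in msupp E); last first.
    rewrite (memN_msupp_eq0 mu_E) mcoeff0 big1 // => j _.
    rewrite big1_seq ?mul0r // => nu /andP[_ nu_E].
    rewrite mcoeffZ mcoeffX; case: eqP nu_E => [->|_ _]; last by rewrite mulr0.
    by rewrite (negPf mu_E).
  have -> : (E@_mu)@_U_(i) = (pihomog mdeg 1 E@_mu)@_U_(i).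
    by rewrite mcoeff_pihomog mdeg1 eqxx.
  rewrite bE raddf_sum; apply: eq_bigr => j _ /=; rewrite mcoeffZ; congr (_ * _).
  rewrite (bigD1_seq mu) ?msupp_uniq //= mcoeffZ mcoeffX eqxx mulr1 big1 ?addr0 // => nu.
  by rewrite mcoeffZ mcoeffX => /negPf ->; rewrite mulr0.
(* By definition of [E], the polynomial [Q] is the combination of the [P j] minus [E], hence the
   sign on the block of the [l j]. *)
exists (row_mx (\row_j - \pi_S (B j)) (\row_j \pi_S (const_part (A j)))) => i.
rewrite mul_row_col mxE [X in X + _]mxE [X in _ + X]mxE.
have -> : v i = \sum_j const_part (A j) * xcoef i (P j) - xcoef i E.
  have -> : xcoef i E = \sum_j const_part (A j) * xcoef i (P j) - v i.
    rewrite /E xcoefB xcoef_sum vQ; congr (_ - _); apply: eq_bigr => j _.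
    by rewrite xcoefM (const_part_bihomog (Pq j)) mulr0 addr0.
  by rewrite opprB addrC subrK.
rewrite xE rmorphB addrC !rmorph_sum -sumrN /= addrC [RHS]addrC; congr (_ + _).
  by apply: eq_bigr => j _; rewrite !mxE rmorphM.
by apply: eq_bigr => j _; rewrite !mxE -xcoefC rmorphM mulNr.
Qed.

End Rows.
End JacobianDualRows.

(** * Rank and null vectors *)

Section FaithfulMinors.
Variable A : comNzRingType.

Definition faithful_minors p q (M : 'M[A]_(p, q)) t : Prop :=
  forall y, (forall (f : 'I_t -> 'I_p) (g : 'I_t -> 'I_q), y * \det (mxsub f g M) = 0) ->
  y = 0.

Lemma has_rank_faithful p q (M : 'M[A]_(p, q)) t : has_rank M t -> faithful_minors M t.
Proof.
move=> [_ [c /lreg_annP creg [s [b [g [gM cE]]]]]] y yM.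
apply: creg; rewrite cE mulr_sumr big1 // => i _.
by case: (gM i) => h [h' ->]; rewrite mulrCA yM mulr0.
Qed.

Lemma faithful_signed_minors p n (M : 'M[A]_(p, n.+1)) y : faithful_minors M n ->
  (forall (f : 'I_n -> 'I_p) l, y * signed_minor (rowsub f M) l = 0) -> y = 0.
Proof.
move=> MF yM; apply: MF => f g.
by have [l [c ->]] := minor_signed_minor M f g; rewrite mulrCA yM mulr0.
Qed.

Lemma faithful_minors_null_vectors p n (M : 'M[A]_(p, n.+1)) (v w : 'cV[A]_n.+1) i j :
  reduced A -> faithful_minors M n -> M *m v = 0 -> M *m w = 0 ->
  v i 0 * w j 0 = v j 0 * w i 0.
Proof.
move=> redA MF Mv Mw; apply/eqP; rewrite -subr_eq0; apply/eqP.
apply: (faithful_signed_minors MF) => f l.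
have rowsub_null (u : 'cV[A]_n.+1) : M *m u = 0 -> rowsub f M *m u = 0.
  move=> Mu; rewrite mul_rowsub_mx Mu.
  by apply/matrixP => r c; rewrite !mxE.
apply: (reduced_mul_sqr redA).
by rewrite mulrC (null_vectors_proportional i j l (rowsub_null _ Mv) (rowsub_null _ Mw)).
Qed.

(** Coordinate [r] of the product is the expansion, along its top row, of the (n + 1)-minor with row
    [r] above the rows [f]. *)
Lemma signed_minors_null_vector p n (M : 'M[A]_(p, n.+1)) (f : 'I_n -> 'I_p) :
  (forall (f : 'I_n.+1 -> 'I_p) (g : 'I_n.+1 -> 'I_n.+1), \det (mxsub f g M) = 0) ->
  M *m (\col_j signed_minor (rowsub f M) j) = 0.
Proof.
move=> M0; apply/colP => r; rewrite !mxE.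
under eq_bigr do rewrite mxE; rewrite -det_row_on_top.
rewrite -[RHS](M0 (fun i => if unlift ord0 i is Some i' then f i' else r) id).
by congr (\det _); apply/matrixP => i j; rewrite !mxE; case: unliftP => [i' _|_];
  rewrite ?mxE.
Qed.

End FaithfulMinors.

Section Rank.
Variables (k : fieldType) (n m d : nat) (a : idealr {mpoly k[n.+1]}).
Variable f : 'I_m.+1 -> {mpoly k[n.+1]}.
Local Notation R := {ideal_quot a}.
Local Notation S := {ideal_quot (image_ideal a f)}.
Local Notation kY := {mpoly k[m.+1]}.
Local Notation x := (fun i : 'I_n.+1 => \pi_R ('X_i : {mpoly k[n.+1]})).
Local Notation y := (fun j : 'I_m.+1 => \pi_S ('X_j : {mpoly k[m.+1]})).
Local Notation incl := (@image_incl k n m a f).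
Local Notation homogS := (@homog_res k m (image_ideal a f)).
Hypotheses (a_homog : homogeneous_ideal a) (R_reduced : reduced R).
Hypotheses (d_gt0 : (0 < d)%N) (f_homog : forall j, f j \is d.-homog).
Hypothesis f_faithful : faithful (fun j => \pi_R (f j)).

Let S_homog : homogeneous_ideal (image_ideal a f).
Proof. exact: image_ideal_homogeneous a_homog d_gt0 f_homog. Qed.

Let S_grading : grading homogS. Proof. exact: homog_res_grading. Qed.

Let S_reduced : reduced S. Proof. exact: image_reduced. Qed.

Let S_noetherian : noetherian S. Proof. exact: noetherian_quot. Qed.

(** Since d > 0, every [f j] lies in the ideal of the variables, and the [f j] have zero joint
    annihilator. *)
Lemma faithful_variables : faithful x.
Proof.
move=> z zx; apply: f_faithful => j.
rewrite [f j]mpolyE raddf_sum mulr_sumr big1_seq // => u /andP[_ u_f].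
have [i ui] : exists i, (U_(i) <= u)%MM.
  apply: NNPP => nu; have /eqP : mdeg u = d by move/dhomogP: (f_homog j) => /(_ u u_f).
  suff -> : u = 0%MM by rewrite mdeg0 => /eqP d0; move: d_gt0; rewrite -d0.
  apply/mnmP => i; rewrite mnm0E; apply/eqP/negPn/negP => ui0; apply: nu.
  by exists i; rewrite lep1mP.
rewrite /=; have -> : \pi_R ((f j)@_u *: 'X_[u]) =
    \pi_R ((f j)@_u *: 'X_[u - U_(i)]) * x i.
  by rewrite -rmorphM -scalerAl -mpolyXD submK.
by rewrite mulrCA zx mulr0.
Qed.

Lemma faithful_image_variables : faithful y.
Proof.
move=> z zy; apply: image_incl_eq0; apply: f_faithful => j.
by rewrite -[f j](substU f j) -image_incl_pi -rmorphM zy rmorph0.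
Qed.

Section RankJacobianDual.
Variables (r s : nat) (psi : 'M[S]_(r + s, n.+1)).
Hypothesis jd : jacobian_dual psi.

Lemma jacobian_dual_minors_gt t (g : 'I_t -> 'I_(r + s)) (h : 'I_t -> 'I_n.+1) :
  (n < t)%N -> \det (mxsub g h psi) = 0.
Proof.
move=> ltnt; apply: image_incl_eq0; rewrite -det_map_mx map_mxsub.
apply: (minors_gt_eq0 g h faithful_variables) ltnt => i.
rewrite -[RHS](jacobian_dual_syzygy jd i).
by apply: eq_bigr => j _; rewrite mxE.
Qed.

Lemma jacobian_dual_minor_form : exists e : 'I_(r + s) -> nat,
  (forall (g : 'I_n -> 'I_(r + s)) (h : 'I_n -> 'I_n.+1),
     homogS (\sum_i e (g i))%N (\det (mxsub g h psi))) /\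
  (forall (g : 'I_n -> 'I_(r + s)) l,
     homogS (\sum_i e (g i))%N (signed_minor (rowsub g psi) l)) /\
  (forall i, (0 < e (rshift r i))%N).
Proof.
have [e [V [Ve psiV e_gt0]]] := jacobian_dual_lift jd; exists e.
have minor_form (g : 'I_n -> 'I_(r + s)) (h : 'I_n -> 'I_n.+1) :
    homogS (\sum_i e (g i))%N (\det (mxsub g h psi)).
  apply: grad_det => // i j; rewrite mxE psiV.
  by exists (V (g i) (h j)).
split=> //; split=> // g l; rewrite /signed_minor -[(\sum_i _)%N]add0n.
apply: (gradM S_grading).
  exists ((-1) ^+ l); last by rewrite rmorphXn rmorphN rmorph1.
  by rewrite -signr_odd; case: odd; rewrite ?rpredN dhomog1.
have -> : col' l (rowsub g psi) = mxsub g (lift l) psi.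
  by apply/matrixP => i j; rewrite !mxE.
exact: minor_form.
Qed.

Lemma jacobian_dual_has_rank : faithful_minors psi n -> has_rank psi n.
Proof.
move=> psiF; split=> [t g h|]; first exact: jacobian_dual_minors_gt.
have [e [minor_form _]] := jacobian_dual_minor_form.
pose T : finType := ({ffun 'I_n -> 'I_(r + s)} * {ffun 'I_n -> 'I_n.+1} * 'I_m.+1)%type.
(* The variable makes the degree positive without creating annihilators, by
   [faithful_image_variables]. *)
pose b (t : T) : S := \det (mxsub t.1.1 t.1.2 psi) * y t.2.
pose deg (t : T) := (\sum_i e (t.1.1 i) + 1)%N.
have [||z zb|D [mul [_ mreg]]] :=
  @homogeneous_avoidance _ _ S_grading S_reduced S_noetherian T b deg.
- by move=> t; rewrite /deg addn1.
- move=> t; apply: (gradM S_grading); first exact: minor_form.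
  by exists 'X_(t.2); rewrite ?dhomogX /= ?mdeg1.
- apply: psiF => g h; apply: faithful_image_variables => j.
  rewrite -mulrA -[RHS](zb (finfun g, finfun h, j)) /b /=; congr (_ * (\det _ * _)).
  by apply/matrixP => i l; rewrite !mxE !ffunE.
exists (\sum_t mul t * b t) => //.
have -> : \sum_t mul t * b t = \sum_t (mul t * y t.2) * \det (mxsub t.1.1 t.1.2 psi).
  by apply: eq_bigr => t _; rewrite /b mulrA mulrAC.
by apply: ideal_gen_fin => t; exists t.1.1, t.1.2.
Qed.

Lemma inverse_has_rank e (g : 'I_n.+1 -> kY) :
  (forall i, g i \is e.-homog) -> faithful (fun i => \pi_S (g i)) ->
  (forall i j, x i * \pi_R (subst f (g j)) = x j * \pi_R (subst f (g i))) ->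
  has_rank psi n.
Proof.
move=> ge gF xg; apply: jacobian_dual_has_rank => z zpsi; apply: gF => j.
(* The syzygies g_j e_i - g_i e_j for all i other than [j]; without column [j] they form the scalar
   matrix g_j. *)
pose v (i' : 'I_n) (c : 'I_n.+1) : kY :=
  (c == lift j i')%:R * g j - (c == j)%:R * g (lift j i').
have vrow i' : exists C : 'rV[S]_(r + s), forall c, \pi_S (v i' c) = (C *m psi) 0 c.
  apply: (jacobian_dual_rowspan (e := e) a_homog jd) => [c|].
    by rewrite /v; apply: rpredB; case: (_ == _); rewrite ?mul1r ?mul0r ?rpred0 ?ge.
  rewrite /linear_syzygy;
  under eq_bigr do rewrite rmorphB !rmorphM !rmorph_nat raddfB mulrBr.
  rewrite big_split /= sumrN (bigD1 (lift j i')) //= eqxx big1 ?addr0; last first.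
    by move=> c /negPf ->; rewrite mul0r rmorph0 mulr0.
  rewrite (bigD1 j) //= eqxx big1 ?addr0 => [|c /negPf ->]; last first.
    by rewrite mul0r rmorph0 mulr0.
  by rewrite !mul1r xg subrr.
have [C CE] := fin_all_exists vrow.
pose N := (\matrix_(i', l) C i' 0 l) *m psi.
have NE i' c : N i' c = \pi_S (v i' c).
  by rewrite CE !mxE; apply: eq_bigr => l _; rewrite !mxE.
have := minors_mulmx_eq0 (\matrix_(i', l) C i' 0 l) zpsi (lift j).
have -> : colsub (lift j) ((\matrix_(i', l) C i' 0 l) *m psi) = (\pi_S (g j))%:M.
  apply/matrixP => i' c; rewrite mxE -/N NE mxE /v (inj_eq lift_inj).
  rewrite [lift j c == j]eq_sym (negPf (neq_lift j c)) mul0r subr0 rmorphM rmorph_nat.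
  by rewrite mulr_natl eq_sym.
rewrite det_scalar; exact: (reduced_mulX S_reduced).
Qed.

Lemma exists_homogeneous_null_vector : has_rank psi n ->
  exists e h, homogeneous_null_vector psi e h.
Proof.
move=> /has_rank_faithful psiF; have [e [_ [minor_form _]]] := jacobian_dual_minor_form.
pose T : finType := ({ffun 'I_n -> 'I_(r + s)} * 'I_n.+1 * 'I_m.+1)%type.
pose b (t : T) : S := signed_minor (rowsub t.1.1 psi) t.1.2 * y t.2.
pose deg (t : T) := (\sum_i e (t.1.1 i) + 1)%N.
have [||z zb|D [mul [[D_gt0 degD mform mm] /lreg_annP mreg]]] :=
  @homogeneous_avoidance _ _ S_grading S_reduced S_noetherian T b deg.
- by move=> t; rewrite /deg addn1.
- move=> t; apply: (gradM S_grading); first exact: minor_form.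
  by exists 'X_(t.2); rewrite ?dhomogX /= ?mdeg1.
- apply: (faithful_signed_minors psiF) => g l; apply: faithful_image_variables => j.
  rewrite -mulrA -[RHS](zb (finfun g, l, j)) /b /=; congr (_ * (signed_minor _ _ * _)).
  by apply/matrixP => i c; rewrite !mxE !ffunE.
(* Different choices of rows give minors of different degrees; the multipliers bring all of them to
   degree D before they are added. *)
pose h c : S := \sum_t mul t * y t.2 * signed_minor (rowsub t.1.1 psi) c.
have hform c : homogS D (h c).
  apply: (grad_sum S_grading) => t _; rewrite -mulrA -[D](subnK (degD t)).
  apply: (gradM S_grading) => //; rewrite mulrC; apply: (gradM S_grading) => //.
  by exists 'X_(t.2); rewrite ?dhomogX /= ?mdeg1.
have hF : faithful h.
  move=> z zh; apply: mreg; rewrite mulr_sumr big1 // => t _.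
  apply: (reduced_mul_sqr S_reduced).
  (* Orthogonality of the multipliers leaves only the term indexed by [t]. *)
  have hE : mul t * h t.1.2 = mul t * (mul t * b t).
    rewrite /h mulr_sumr (bigD1 t) //= big1 ?addr0 => [|t' t't].
      by rewrite /b -mulrA [y t.2 * _]mulrC.
    by rewrite !mulrA mm 1?eq_sym // !mul0r.
  have -> : z * (mul t * b t * (mul t * b t)) = z * (mul t * (mul t * b t)) * b t by ring.
  by rewrite -hE [z * (_ * _)]mulrCA zh mulr0 mul0r.
have [H Hhom hH] := fin_all_exists2 hform.
exists D, H; split=> //.
  have -> : \col_c \pi_S (H c) =
      \sum_t (mul t * y t.2) *: \col_c signed_minor (rowsub t.1.1 psi) c.
    apply/colP => c; rewrite mxE -hH summxE /h.
    by apply: eq_bigr => t _; rewrite !mxE.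
  rewrite /null_space mulmx_sumr big1 // => t _; rewrite -scalemxAr.
  rewrite signed_minors_null_vector ?scaler0 // => g g'.
  exact: jacobian_dual_minors_gt.
(* Avoidance is used again, now for the coordinates themselves, to find a regular element in their
   ideal. *)
have [||D' [mul' [_ mreg']]] :=
  @homogeneous_avoidance _ _ S_grading S_reduced S_noetherian _ h (fun=> D) _ _ hF => //.
exists (\sum_i mul' i * h i) => //; apply: ideal_gen_fin => i.
by exists i.
Qed.

End RankJacobianDual.
End Rank.

Lemma has_rank_map (A B : comNzRingType) (h : {rmorphism A -> B}) p q
    (M : 'M[A]_(p, q)) t :
  (forall x, GRing.lreg x -> GRing.lreg (h x)) ->
  has_rank M t -> has_rank (map_mx h M) t.
Proof.
move=> hreg [M0 [c creg [s [b [g [gM cE]]]]]]; split=> [u f f' ltu|].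
  by rewrite -map_mxsub det_map_mx M0 ?rmorph0.
exists (h c); first exact: hreg.
rewrite cE rmorph_sum; under eq_bigr do rewrite rmorphM.
apply: (ideal_gen_fin (fun i => h (b i)) (g := fun i => h (g i))) => i.
by have [f [f' ->]] := gM i; exists f, f'; rewrite -map_mxsub det_map_mx.
Qed.

Lemma pi_component (k : fieldType) n (I : idealr {mpoly k[n.+1]}) p d :
  component (homog_res (I := I)) (\pi_{ideal_quot I} p) d
    (\pi_{ideal_quot I} (pihomog mdeg d p)).
Proof.
exists (maxn (msize p) d.+1), (fun i => \pi_{ideal_quot I} (pihomog mdeg i p)).
split=> //; last by rewrite leq_maxr.
  by move=> i; exists (pihomog mdeg i p) => //; apply: pihomogP.
by rewrite -raddf_sum -pihomog_partitionE // leq_maxl.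
Qed.

(** * Inverse maps *)

Section Homogenize.
Variables (k : fieldType) (n m : nat) (B : comNzRingType).
Variables (phi : {rmorphism {mpoly k[n.+1]} -> B}).
Variables (f : 'I_m.+1 -> {mpoly k[n.+1]}) (h : 'I_n.+1 -> {mpoly k[m.+1]}).
Variables (F F' : B).
Hypothesis FF' : forall i, F * phi 'X_i = F' * phi (subst f (h i)).

(** [phi] is kept arbitrary: it is the residue map to R for the whole map, and to R/P for its
    restriction to a component. *)
Lemma rescale_subst t (q : {mpoly k[n.+1]}) : q \is t.-homog ->
  F ^+ t * phi q = F' ^+ t * phi (subst f (subst h q)).
Proof.
move=> qt; rewrite subst_comp -[in LHS](substX_id q) !rmorph_subst.
by rewrite -!mmap_scale //; apply: mmap_eq.
Qed.

Lemma rescale_subst_eq0 t (q : {mpoly k[n.+1]}) : q \is t.-homog ->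
  GRing.lreg F -> GRing.lreg F' ->
  (phi q = 0 <-> phi (subst f (subst h q)) = 0).
Proof.
move=> /rescale_subst E Freg F'reg; split=> q0.
  by apply: (lregX (n := t) F'reg); rewrite mulr0 -E q0 mulr0.
by apply: (lregX (n := t) Freg); rewrite mulr0 E q0 mulr0.
Qed.

End Homogenize.

Section Inverse.
Variables (k : fieldType) (n m d : nat) (a : idealr {mpoly k[n.+1]}).
Variable f : 'I_m.+1 -> {mpoly k[n.+1]}.
Local Notation R := {ideal_quot a}.
Local Notation S := {ideal_quot (image_ideal a f)}.
Local Notation kX := {mpoly k[n.+1]}.
Local Notation kY := {mpoly k[m.+1]}.
Local Notation x := (fun i : 'I_n.+1 => \pi_R ('X_i : {mpoly k[n.+1]})).
Local Notation ev q := (\pi_R (subst f q)).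
Local Notation incl := (@image_incl k n m a f).
Local Notation homogR := (@homog_res k n a).
Hypotheses (a_homog : homogeneous_ideal a) (R_reduced : reduced R).
Hypothesis f_datum : rational_datum a d f.

Let d_gt0 : (0 < d)%N. Proof. by case: f_datum. Qed.

Let f_homog j : f j \is d.-homog. Proof. by case: f_datum. Qed.

Lemma datum_faithful : faithful (fun j => \pi_R (f j)).
Proof.
by apply/(faithful_minimal_primeP R_reduced); [apply: noetherian_quot|case: f_datum].
Qed.

Let f_faithful := datum_faithful.

Let S_homog : homogeneous_ideal (image_ideal a f).
Proof. exact: image_ideal_homogeneous a_homog d_gt0 f_homog. Qed.

Let S_reduced : reduced S. Proof. exact: image_reduced. Qed.

Let S_noetherian : noetherian S. Proof. exact: noetherian_quot. Qed.

(** An element regular in S is regular in the subring k[f], and torsionfreeness extends this to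
    R. *)
Lemma image_incl_lreg s : GRing.lreg s -> GRing.lreg (incl s).
Proof.
move=> /lreg_annP sreg; have [_ _ tf _] := f_datum; apply: tf.
  by elim/quotW: s {sreg} => q; exists q; rewrite image_incl_pi.
move=> _ [q ->]; rewrite -image_incl_pi -rmorphM => /image_incl_eq0.
by rewrite mulrC => /sreg ->; rewrite rmorph0.
Qed.

Section RatEquiv.
Variables (e : nat) (h : 'I_n.+1 -> kY).
Hypotheses (e_gt0 : (0 < e)%N) (h_homog : forall i, h i \is e.-homog).
Hypothesis h_equiv : rat_equiv a (fun i => subst f (h i)) (fun i => 'X_i).

Lemma rat_equiv_proportional i j : x i * ev (h j) = x j * ev (h i).
Proof.
have [F [F' [_ _ Freg F'reg FF']]] := h_equiv; apply: F'reg.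
have E l : \pi_R F * x l = \pi_R F' * ev (h l) by rewrite -!rmorphM; apply: FF'.
rewrite mulrCA -E [RHS]mulrCA -E mulrCA [RHS]mulrCA; congr (_ * _); exact: mulrC.
Qed.

(** Thus k[h] inside S is again a copy of k[X]/a. Forms are compared through F^t q(x) = F'^t
    q(h(f)), and homogeneity of both ideals gives the general case. *)
Lemma rat_equiv_ideal q : q \in a <-> \pi_S (subst h q) = 0.
Proof.
have [F [F' [_ _ Freg F'reg FF']]] := h_equiv.
have formP t q' : q' \is t.-homog -> (q' \in a <-> \pi_S (subst h q') = 0).
  move=> q't; have E : \pi_R q' = 0 <-> ev (subst h q') = 0.
    apply: (rescale_subst_eq0 _ q't Freg F'reg) => i.
    by rewrite -!rmorphM; apply: FF'.
  split=> [/pi_idealP/E q'0|q'0].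
    by apply: image_incl_eq0; rewrite image_incl_pi.
  by apply/pi_idealP/E; rewrite -image_incl_pi q'0 rmorph0.
split=> [qa|q0].
  have -> : \pi_S (subst h q) = \sum_(t < msize q) \pi_S (subst h (pihomog mdeg t q)).
    by rewrite -rmorph_sum -rmorph_sum -pihomog_partitionE.
  rewrite big1 // => t _.
  exact: (proj1 (formP t _ (pihomogP _ _ _)) (a_homog t qa)).
rewrite (@pihomog_partitionE _ _ mdeg (msize q) q) //; apply: rpred_sum => t _.
apply: (proj2 (formP t _ (pihomogP _ _ _))).
rewrite -(pihomog_subst _ _ e_gt0 h_homog); apply/pi_idealP/S_homog.
exact/pi_idealP.
Qed.

(* If z kills q(h), then F ^ t q_t(x) = F' ^ t q_t(h(f)) shows that z, seen in R as a
   polynomial w(x), kills q(x); applying h again, w(h) kills q(h) inside k[h]. *)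
Lemma rat_equiv_torsionfree :
  torsionfree_over (fun s : S => exists q, s = \pi_S (subst h q)).
Proof.
move=> _ [q ->] hq; apply/lreg_annP => z zq; apply/eqP/negPn/negP.
have S_grading := homog_res_grading S_homog.
move=> /(component_neq0 S_grading)[l [z' [zz' z'0]]].
have z'q t : z' * \pi_S (subst h (pihomog mdeg t q)) = 0.
  rewrite -(pihomog_subst _ _ e_gt0 h_homog).
  exact: (component_mul0 S_grading S_reduced zz'
    (pi_component (image_ideal a f) (subst h q) (e * t)) zq).
have [w wl z'E] := component_homog zz'; pose w' := subst f w.
have [F [F' [_ _ Freg F'reg FF']]] := h_equiv.
have w'q t : w' * pihomog mdeg t q \in a.
  apply/pi_idealP; apply: (lregX (n := t) Freg); rewrite mulr0 rmorphM /= mulrCA.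
  have -> : \pi_R F ^+ t * \pi_R (pihomog mdeg t q) =
      \pi_R F' ^+ t * ev (subst h (pihomog mdeg t q)).
    apply: rescale_subst (pihomogP _ _ _) => i.
    by rewrite -!rmorphM; apply: FF'.
  have -> : \pi_R w' = incl z' by rewrite z'E image_incl_pi.
  by rewrite mulrCA -image_incl_pi -rmorphM z'q rmorph0 mulr0.
have /rat_equiv_ideal : w' * q \in a.
  rewrite (@pihomog_partitionE _ _ mdeg (msize q) q) // mulr_sumr.
  by apply: rpred_sum => t _.
rewrite rmorphM rmorphM mulrC => /hq w'0.
have /rat_equiv_ideal : \pi_S (subst h w') = 0 by apply: w'0; exists w'.
move=> /pi_idealP; rewrite -image_incl_pi -z'E => /image_incl_eq0 /eqP.
by rewrite (negPf z'0).
Qed.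

End RatEquiv.

Section RankN.
Variables (r s : nat) (psi : 'M[S]_(r + s, n.+1)).
Hypotheses (jd : jacobian_dual psi) (psi_rank : has_rank psi n).

Lemma null_vector_inverse_datum e h :
  homogeneous_null_vector psi e h -> inverse_datum a f e h.
Proof.
case=> e_gt0 h_homog psih [c creg hc].
have hF : faithful (fun i => ev (h i)).
  apply: (faithful_ideal (image_incl_lreg creg)).
  case: hc => t [b [g [gh ->]]]; rewrite rmorph_sum; under eq_bigr do rewrite rmorphM.
  apply: (ideal_gen_fin (fun i => incl (b i)) (g := fun i => incl (g i))) => i.
  by have [j ->] := gh i; exists j; rewrite image_incl_pi.
have xF := faithful_variables d_gt0 f_homog f_faithful.
have xh i j : x i * ev (h j) = x j * ev (h i).
  have rk := has_rank_faithful (has_rank_map image_incl_lreg psi_rank).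
  have Mx : map_mx incl psi *m (\col_i x i) = 0.
    apply/colP => l; rewrite !mxE -[RHS](jacobian_dual_syzygy jd l).
    by apply: eq_bigr => c' _; rewrite !mxE.
  have Mh : map_mx incl psi *m (\col_i ev (h i)) = 0.
    have -> : \col_i ev (h i) = map_mx incl (\col_i \pi_S (h i)).
      by apply/colP => l; rewrite !mxE image_incl_pi.
    by rewrite -map_mxM psih map_mx0.
  by have := faithful_minors_null_vectors i j R_reduced rk Mx Mh; rewrite !mxE.
have h_equiv : rat_equiv a (fun i => subst f (h i)) (fun i => 'X_i).
  have R_grading := homog_res_grading a_homog.
  have [||D [mul [[D0 degD mulform _] mreg]]] := @homogeneous_avoidance _ homogR
    R_grading R_reduced (noetherian_quot (I := a)) _ (fun i => ev (h i))
    (fun=> (d * e)%N) _ _ hF.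
  - by move=> _; rewrite muln_gt0 d_gt0.
  - by move=> i; exists (subst f (h i)) => //; apply: dhomog_subst.
  have [F FD FE] : homogR D (\sum_i mul i * ev (h i)).
    apply: (grad_sum R_grading) => i _; rewrite -[D](subnK (degD i)).
    by apply: (gradM R_grading) => //; exists (subst f (h i)) => //; apply: dhomog_subst.
  have [F' FD' FE'] : homogR (D - d * e + 1)%N (\sum_i mul i * x i).
    apply: (grad_sum R_grading) => i _.
    apply: (gradM R_grading); first exact: mulform i.
    by exists 'X_i; rewrite ?dhomogX /= ?mdeg1.
  exists F, F'; split; [by exists D|by exists (D - d * e + 1)%N| | |].
  - by rewrite -FE.
  (* Here F' h_i(f) = F x_i, so an element [z] killing F' satisfies z x_i F = 0, whence z x_i = 0
     for all [i]. *)
  - rewrite -FE'; apply/lreg_annP => z zx; apply: xF => i.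
    move/lreg_annP: mreg; apply.
    transitivity (z * (\sum_j mul j * x j) * ev (h i)); last by rewrite zx mul0r.
    rewrite -!mulrA; congr (_ * _); rewrite mulr_sumr mulr_suml.
    by apply: eq_bigr => j _; rewrite mulrCA xh mulrA.
  - move=> j; rewrite !rmorphM /= -FE -FE' !mulr_suml; apply: eq_bigr => i _.
    by rewrite -!mulrA [ev (h i) * _]mulrC xh.
split=> //; split=> //; first exact: (rat_equiv_torsionfree e_gt0 h_homog h_equiv).
apply/(faithful_minimal_primeP S_reduced S_noetherian).
exact: faithful_ideal creg hc.
Qed.

Lemma null_space_rank_one : has_rank_one (null_space psi).
Proof.
have [e [h [e_gt0 h_homog psih [c creg hc]]]] :=
  exists_homogeneous_null_vector a_homog R_reduced d_gt0 f_homog f_faithful jd psi_rank.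
exists (\col_i \pi_S (h i)); split=> // [z /colP zh|w psiw].
  apply: (faithful_ideal creg hc) => i.
  by have := zh i; rewrite !mxE.
have [b cE] := ideal_gen_range hc.
(* With c = sum b_j h_j regular, proportionality of [w] and [h] gives c w = (sum b_j w_j) h. *)
exists c, (\sum_i b i * w i 0); split=> //.
apply/colP => i; rewrite !mxE cE !mulr_suml; apply: eq_bigr => j _.
have := faithful_minors_null_vectors i j S_reduced (has_rank_faithful psi_rank) psiw psih.
by rewrite !mxE -!mulrA => E; rewrite [\pi_S _ * _]mulrC E.
Qed.

End RankN.

Lemma inverse_datum_has_rank e h r s (psi : 'M[S]_(r + s, n.+1)) :
  inverse_datum a f e h -> jacobian_dual psi -> has_rank psi n.
Proof.
case=> [[e_gt0 h_homog _ hP]] h_equiv jd.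
apply: (inverse_has_rank a_homog R_reduced d_gt0 f_homog f_faithful jd h_homog).
  exact/(faithful_minimal_primeP S_reduced S_noetherian).
exact: rat_equiv_proportional.
Qed.

Lemma birational_jdrank : birational a f <-> jdrank_is a f n.
Proof.
split=> [[e [h hinv]]|[r [s [psi [jd rk]]]]].
  have [r [s [psi jd]]] := exists_jacobian_dual a f.
  exists r, s, psi; split=> //; exact: inverse_datum_has_rank hinv jd.
have [e [h hnull]] := exists_homogeneous_null_vector a_homog R_reduced
  d_gt0 f_homog f_faithful jd rk.
by exists e, h; apply: null_vector_inverse_datum hnull.
Qed.

End Inverse.

(** * Null vectors made of the signed minors of n rows *)

Section SignedMinors.
Variables (k : fieldType) (n m d : nat) (a : idealr {mpoly k[n.+1]}).
Variable f : 'I_m.+1 -> {mpoly k[n.+1]}.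
Local Notation R := {ideal_quot a}.
Local Notation S := {ideal_quot (image_ideal a f)}.
Hypotheses (a_homog : homogeneous_ideal a) (R_reduced : reduced R).
Hypothesis f_datum : rational_datum a d f.
Variables (r s : nat) (psi : 'M[S]_(r + s, n.+1)).
Hypotheses (jd : jacobian_dual psi).

Lemma jacobian_dual_dgi : (r <= dgi a)%N.
Proof.
have [l [P [[l1 lfree _] _ _ _]]] := jd; have [l' l'B] := dgi_basis a.
exact: a1_basis_max l'B l1 lfree.
Qed.

(** The delicate point is positive degree. In degree 0 all chosen rows would come from the [l j];
    they are distinct because some minor is nonzero, so n <= r <= dgi(a), against edim > 1. *)
Lemma signed_minors_null_datum (rows : 'I_n -> 'I_(r + s)) :
  (1 < edim a)%N -> has_rank (rowsub rows psi) n ->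
  exists e g, homogeneous_null_vector psi e g /\
    forall j, \pi_S (g j) = signed_minor (rowsub rows psi) j.
Proof.
move=> edim_gt1 rk; have [d_gt0 f_homog _ _] := f_datum.
have fF := datum_faithful R_reduced f_datum.
have [e [_ [minor_form e_gt0]]] := jacobian_dual_minor_form a_homog d_gt0 f_homog jd.
have [g g_homog gE] := fin_all_exists2 (minor_form rows).
exists (\sum_i e (rows i))%N, g; split=> //; split=> //.
- rewrite lt0n; apply/negP; rewrite sum_nat_eq0 => /forallP e0.
  have rowsE i : exists i', rows i = lshift s i'.
    case: (split_ordP (rows i)) => i' rE; first by exists i'.
    by have := e_gt0 i'; rewrite -rE lt0n; move: (e0 i) => /= ->.
  have [rho rhoE] := fin_all_exists rowsE.
  have rho_inj : injective rho.
    apply: NNPP => rho_ninj; have := oner_neq0 S; case/eqP.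
    apply: (has_rank_faithful rk) => u v; rewrite mul1r.
    have -> : mxsub u v (rowsub rows psi) = mxsub (rows \o u) v psi.
      by apply/matrixP => i j; rewrite !mxE.
    apply: det_mxsub_ninj; left => inj; apply: rho_ninj => i j rij.
    have u_inj : injective u by move=> i' j' uij; apply: inj; rewrite /= uij.
    rewrite -(f_invF u_inj i) -(f_invF u_inj j); congr u; apply: inj.
    by rewrite /= !f_invF !rhoE rij.
  have := leq_card rho rho_inj; rewrite !card_ord => le_nr.
  by move: edim_gt1 (leq_trans le_nr jacobian_dual_dgi); rewrite /edim; lia.
- have -> : \col_i \pi_S (g i) = \col_j signed_minor (rowsub rows psi) j.
    by apply/colP => j; rewrite !mxE gE.
  apply: signed_minors_null_vector => u v.
  exact: (jacobian_dual_minors_gt d_gt0 f_homog fF jd).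
have [_ [c creg hc]] := rk; exists c => //; move: hc.
apply: ideal_gen_min; first exact: ideal_gen_ideal.
move=> _ [u [v ->]].
(* Permuting or repeating rows only multiplies the minor by the determinant of [rowsub u 1%:M]. *)
have -> : mxsub u v (rowsub rows psi) = rowsub u 1%:M *m mxsub id v (rowsub rows psi).
  by rewrite -rowsubE; apply/matrixP => i j; rewrite !mxE.
rewrite det_mulmx; have [l [b ->]] := minor_signed_minor (rowsub rows psi) id v.
rewrite mulrA; apply: idealM; first exact: ideal_gen_ideal.
apply: ideal_gen_sub; exists l; rewrite -gE.
by congr signed_minor; apply/matrixP => i j; rewrite !mxE.
Qed.

End SignedMinors.

(** * Irreducible components *)

Section Component.
Variables (k : fieldType) (n m d : nat) (a : idealr {mpoly k[n.+1]}).
Variable f : 'I_m.+1 -> {mpoly k[n.+1]}.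
Local Notation R := {ideal_quot a}.
Local Notation S := {ideal_quot (image_ideal a f)}.
Local Notation kX := {mpoly k[n.+1]}.
Local Notation kY := {mpoly k[m.+1]}.
Local Notation incl := (@image_incl k n m a f).
Hypotheses (a_homog : homogeneous_ideal a) (R_reduced : reduced R).
Hypothesis f_datum : rational_datum a d f.

Let d_gt0 : (0 < d)%N. Proof. by case: f_datum. Qed.
Let f_homog j : f j \is d.-homog. Proof. by case: f_datum. Qed.
Let R_noetherian : noetherian R. Proof. exact: noetherian_quot. Qed.
Let R_grading := homog_res_grading a_homog.
Let S_reduced : reduced S. Proof. exact: image_reduced. Qed.
Let S_homog : homogeneous_ideal (image_ideal a f).
Proof. exact: image_ideal_homogeneous a_homog d_gt0 f_homog. Qed.
Let S_grading := homog_res_grading S_homog.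
Let S_noetherian : noetherian S. Proof. exact: noetherian_quot. Qed.

Section MinimalPrime.
Variable P : prime_idealr R.
Hypothesis P_min : minimal_prime P.
Local Notation aP := (preim_ideal P).
Local Notation RP := {ideal_quot aP}.
Local Notation SP := {ideal_quot (image_ideal aP f)}.

Lemma in_preim p : (p \in aP) = (\pi_R p \in P).
Proof. by []. Qed.

Lemma preim_prime p q : (p * q \in aP) = (p \in aP) || (q \in aP).
Proof. by rewrite !in_preim rmorphM prime_idealrM. Qed.

(** P is the annihilator of some [z], and in a reduced graded ring p z = 0 forces every component of
    [p] to kill every component of [z]. *)
Lemma preim_homogeneous : homogeneous_ideal aP.
Proof.
move=> p e; rewrite !in_preim.
have [z z0 PE] := minimal_prime_ann R_reduced R_noetherian P_min.
rewrite !PE => /eqP pz; apply/eqP; rewrite mulrC.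
apply: (component_mul R_grading) => l z' zz'; rewrite mulrC.
exact: (component_mul0 R_grading R_reduced (pi_component a p e) zz' pz).
Qed.

Lemma preim_domain (u v : RP) : u * v = 0 -> u = 0 \/ v = 0.
Proof.
elim/quotW: u => p; elim/quotW: v => q.
by rewrite -rmorphM => /pi_idealP; rewrite preim_prime => /orP[]/pi_idealP; [left|right].
Qed.

Lemma preim_reduced : reduced RP.
Proof.
move=> u; elim=> [/eqP|e IHe]; first by rewrite expr0 oner_eq0.
by rewrite exprS => /preim_domain[].
Qed.

Lemma preim_lreg p : p \notin aP -> GRing.lreg (\pi_RP p).
Proof.
move=> pP; apply/lreg_annP => u /preim_domain[//|/pi_idealP].
by rewrite (negPf pP).
Qed.

Lemma preim_faithful : faithful (fun j => \pi_RP (f j)).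
Proof.
have [_ _ _ /(_ _ P_min)[j fj]] := f_datum.
move=> u uf; have /lreg_annP := preim_lreg fj; apply; exact: uf.
Qed.

Lemma preim_sub p : p \in a -> p \in aP.
Proof. by move=> /pi_idealP p0; rewrite in_preim p0 rpred0. Qed.

Lemma image_preim_eq0 q : (\pi_SP q == 0) = (incl (\pi_S q) \in P).
Proof. by rewrite pi_eq0 image_incl_pi. Qed.

Section Inverse.
Variables (e : nat) (h : 'I_n.+1 -> kY).
Hypothesis h_inv : inverse_datum a f e h.

Lemma preim_rescale : exists F F' : kX,
  [/\ F \notin aP, F' \notin aP &
      forall i, \pi_RP F * \pi_RP 'X_i = \pi_RP F' * \pi_RP (subst f (h i))].
Proof.
have [_ [F [F' [_ _ Freg F'reg FF']]]] := h_inv; exists F, F'; split.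
- exact: notin_minimal_prime P_min Freg.
- exact: notin_minimal_prime P_min F'reg.
move=> i; rewrite -!rmorphM; apply/eqP; rewrite -subr_eq0 -rmorphB pi_eq0 preim_sub //.
by rewrite -pi_eq0 rmorphB /= FF' subrr.
Qed.

(** The inverse recovers P from its contraction to k[f]; this is why a birational map separates
    components. *)
Lemma preim_inverse_ideal q : q \in aP <-> subst h q \in image_ideal aP f.
Proof.
have [[e_gt0 h_homog _ _] _] := h_inv; have [F [F' [FP F'P FF']]] := preim_rescale.
have imP : homogeneous_ideal (image_ideal aP f).
  exact: image_ideal_homogeneous preim_homogeneous d_gt0 f_homog.
have formP t q' : q' \is t.-homog -> (q' \in aP <-> subst h q' \in image_ideal aP f).
  move=> q't; have [E E'] := rescale_subst_eq0 FF' q't (preim_lreg FP) (preim_lreg F'P).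
  by split=> [/pi_idealP/E/pi_idealP|q'P] //; apply/pi_idealP/E'/pi_idealP.
split=> qP.
  rewrite (@pihomog_partitionE _ _ mdeg (msize q) q) // rmorph_sum.
  apply: rpred_sum => t _.
  exact: (proj1 (formP t _ (pihomogP _ _ _)) (preim_homogeneous t qP)).
rewrite (@pihomog_partitionE _ _ mdeg (msize q) q) //; apply: rpred_sum => t _.
apply: (proj2 (formP t _ (pihomogP _ _ _))).
by rewrite -(pihomog_subst _ _ e_gt0 h_homog); apply: imP.
Qed.

(** The inverse of the whole map still gives the required syzygies modulo P: [F] and [F'] lie
    outside P and can be cancelled in the domain R/P. *)
Lemma preim_jdrank : jdrank_is aP f n.
Proof.
have [[e_gt0 h_homog _ _] _] := h_inv; have [F [F' [FP F'P FF']]] := preim_rescale.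
have [r [s [psi jd]]] := exists_jacobian_dual aP f; exists r, s, psi; split=> //.
have xF := faithful_variables d_gt0 f_homog preim_faithful.
apply: (inverse_has_rank preim_homogeneous preim_reduced d_gt0 f_homog
  preim_faithful jd h_homog).
  move=> z zh; apply: image_incl_eq0; apply: xF => i; apply: (preim_lreg FP).
  rewrite mulr0 mulrCA FF' mulrCA -image_incl_pi -rmorphM zh rmorph0 mulr0 //.
move=> i j; apply: (preim_lreg F'P); rewrite mulrCA -FF' [RHS]mulrCA -FF'.
by rewrite mulrCA [RHS]mulrCA; congr (_ * _); apply: mulrC.
Qed.

End Inverse.

(* Otherwise the contraction of P contains an element regular in S, hence in R. *)
Lemma contraction_ann : exists z : S,
  [/\ z != 0, exists l, homog_res l z & forall s, incl s \in P -> z * s = 0].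
Proof.
pose G (s : S) := incl s \in P /\ exists l, homog_res l s.
have [t [g [gG gI]]] := noetherian_gens G S_noetherian.
have [deg gdeg] := fin_all_exists (fun i => (gG i).2).
have IG s : incl s \in P -> ideal_gen G s.
  elim/quotW: s => q; rewrite image_incl_pi => qP.
  have -> : \pi_S q = \sum_(i < msize q) 1 * \pi_S (pihomog mdeg i q).
    by under eq_bigr do rewrite mul1r; rewrite -rmorph_sum -pihomog_partitionE.
  apply: (ideal_gen_fin (fun=> 1) (g := fun i : 'I_(msize q) =>
    \pi_S (pihomog mdeg i q))) => i.
  split; last by exists i, (pihomog mdeg i q) => //; apply: pihomogP.
  rewrite image_incl_pi -(pihomog_subst _ _ d_gt0 f_homog).
  exact: preim_homogeneous qP.
have kill z : (forall i, z * g i = 0) -> forall s, incl s \in P -> z * s = 0.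
  move=> zg s /IG/gI; apply: (@ideal_gen_min _ _ (fun s => z * s = 0)).
    split=> [|c u v zu zv]; first by rewrite mulr0.
    by rewrite mulrDr mulrCA zu zv mulr0 addr0.
  by move=> _ [i ->].
have [z z0 zg] : exists2 z, z != 0 & forall i, z * g i = 0.
  apply: NNPP => ng.
  have gF : faithful g.
    by move=> z zg; apply/eqP/negPn/negP => z0; apply: ng; exists z.
  pose b (ij : 'I_t * 'I_m.+1) : S := g ij.1 * \pi_S 'X_(ij.2).
  have [||z zb|D [mul [_ mreg]]] := @homogeneous_avoidance _ _ S_grading S_reduced
    S_noetherian _ b (fun ij => deg ij.1 + 1)%N.
  - by move=> ij; rewrite addn1.
  - move=> ij; apply: (gradM S_grading) => //.
    by exists 'X_(ij.2); rewrite ?dhomogX /= ?mdeg1.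
  - apply: gF => i; apply:
      (faithful_image_variables (datum_faithful R_reduced f_datum)) => j.
    by rewrite -mulrA; apply: (zb (i, j)).
  have := notin_minimal_prime R_reduced R_noetherian P_min (image_incl_lreg f_datum mreg).
  case/negP; rewrite rmorph_sum; apply: rpred_sum => ij _.
  have -> : mul ij * b ij = mul ij * \pi_S 'X_(ij.2) * g ij.1 by rewrite /b mulrA mulrAC.
  by rewrite rmorphM; apply: idealMr; case: (gG ij.1).
have [l [z' [zz' z'0]]] := component_neq0 S_grading z0.
exists z'; split=> //; first by exists l; apply: component_homog zz'.
apply: kill => i; apply: (component_mul0 S_grading S_reduced zz' _ (zg i)).
exact: homog_component (gdeg i).
Qed.

End MinimalPrime.

Lemma birational_separates : birational a f -> separates_components a f.
Proof.
move=> [e [h h_inv]] P Q P_min Q_min PQ.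
elim/quotW => p; rewrite -!in_preim.
have [hP hP'] := preim_inverse_ideal P_min h_inv p.
have [hQ hQ'] := preim_inverse_ideal Q_min h_inv p.
by apply/idP/idP => [/hP hp|/hQ hp]; [apply: hQ'; rewrite -PQ|apply: hP'; rewrite PQ].
Qed.

(** Suppose z w is nonzero with [w] in P. A minimal prime Q omitting z w omits [z]; since [z] kills
    the contraction of P, that contraction lies in the one of Q. The element killing the contraction
    of Q gives the converse. So P = Q, although [w] lies only in P. *)
Lemma separates_isolates (P : prime_idealr R) : separates_components a f ->
  minimal_prime P -> exists z : S,
  [/\ incl z \notin P, exists l, homog_res l z & forall w, w \in P -> incl z * w = 0].
Proof.
move=> sep P_min; have [z [z0 zform zP]] := contraction_ann P_min.
(* If [u] lay in Q it would kill itself, and S is reduced. *)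
have nz (Q : prime_idealr R) (u : S) : u != 0 ->
    (forall s, incl s \in Q -> u * s = 0) -> incl u \notin Q.
  by move=> u0 uQ; apply: contra_neqN u0 => /uQ /(reduced_sqr S_reduced).
exists z; split=> //; first exact: nz.
move=> w wP; apply/eqP/negPn/negP.
move=> /(exists_minimal_prime R_reduced R_noetherian)[Q [Q_min]].
rewrite prime_idealrM negb_or => /andP[zQ wQ] _.
have [z' [z'0 _ z'Q]] := contraction_ann Q_min.
suff PQ : image_ideal (preim_ideal P) f =i image_ideal (preim_ideal Q) f.
  by move: wQ; rewrite -(sep _ _ P_min Q_min PQ) wP.
have inE' (T : prime_idealr R) q :
    (q \in image_ideal (preim_ideal T) f) = (incl (\pi_S q) \in T).
  by rewrite image_incl_pi.
move=> q; rewrite !inE'; apply/idP/idP => [/zP zq|/[dup] qQ /z'Q z'q].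
  have : incl z * incl (\pi_S q) \in Q by rewrite -rmorphM zq rmorph0 rpred0.
  by rewrite prime_idealrM (negPf zQ).
apply: contraT => qP; case/negP: (nz Q z' z'0 z'Q).
have : incl z' * incl (\pi_S q) \in P by rewrite -rmorphM z'q rmorph0 rpred0.
rewrite prime_idealrM (negPf qP) orbF => z'P.
have /zP zz' := z'P.
have : incl z * incl z' \in Q by rewrite -rmorphM zz' rmorph0 rpred0.
by rewrite prime_idealrM (negPf zQ).
Qed.

(** If [y] kills the n-minors of [psi] and P omits [y], multiplication by [z] makes the rows of
    [psiP] combinations of the rows of [psi]. So y z^n kills the lifted n-minors of [psiP]; as [y]
    and [z] lie outside P, these minors vanish modulo P, against rank n. *)
Lemma components_jdrank : separates_components a f ->
  (forall P : prime_idealr R, minimal_prime P -> jdrank_is (preim_ideal P) f n) ->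
  jdrank_is a f n.
Proof.
move=> sep jdP; have [r [s [psi jd]]] := exists_jacobian_dual a f.
exists r, s, psi; split=> //.
apply: (jacobian_dual_has_rank a_homog R_reduced d_gt0 f_homog _ jd).
  exact: datum_faithful f_datum.
move=> y ypsi; apply: image_incl_eq0; apply/eqP/negPn/negP.
move=> /(exists_minimal_prime R_reduced R_noetherian)[P [P_min yP] _].
have [z [zP [l [w wl zE]] zann]] := separates_isolates sep P_min.
have [rP [sP [psiP [jdPP rkP]]]] := jdP P P_min.
have [eP [V [Vhom psiV _]]] := jacobian_dual_lift jdPP.
(* The rank of [psiP] is contradicted by taking 1 as an element that kills all its n-minors. *)
have : (1 : {ideal_quot (image_ideal (preim_ideal P) f)}) = 0; last first.
  by move/eqP; rewrite oner_eq0.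
apply: (has_rank_faithful rkP) => u v; rewrite mul1r.
pose D := \det (\matrix_(i, j) V (u i) (v j)).
have -> : mxsub u v psiP = map_mx (\pi_{ideal_quot (image_ideal (preim_ideal P) f)})
    (\matrix_(i, j) V (u i) (v j)).
  by apply/matrixP => i j; rewrite !mxE psiV.
rewrite det_map_mx; apply/eqP; rewrite image_preim_eq0.
have row i : exists C : 'rV[S]_(r + s),
    forall c, \pi_S (w * V (u i) c) = (C *m psi) 0 c.
  apply: (jacobian_dual_rowspan a_homog jd) => [c|]; first exact: dhomogM wl (Vhom _ _).
  have E c : \pi_R 'X_c * \pi_R (subst f (w * V (u i) c)) =
      incl z * (\pi_R 'X_c * \pi_R (subst f (V (u i) c))).
    by rewrite zE image_incl_pi mulrCA -!rmorphM.
  rewrite /linear_syzygy; under eq_bigr do rewrite E.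
  rewrite -mulr_sumr; apply: zann.
  have : \sum_j 'X_j * subst f (V (u i) j) \in preim_ideal P.
    apply/pi_idealP; rewrite raddf_sum -[RHS](jacobian_dual_syzygy jdPP (u i)).
    by apply: eq_bigr => j _; rewrite psiV image_incl_pi /= rmorphM mulrC.
  by rewrite in_preim rmorph_sum; under eq_bigr do rewrite rmorphM.
have [C CE] := fin_all_exists row.
have := minors_mulmx_eq0 (\matrix_(i, j) C i 0 j) ypsi v.
have -> : colsub v ((\matrix_(i, j) C i 0 j) *m psi) =
    z *: map_mx \pi_S (\matrix_(i, j) V (u i) (v j)).
  apply/matrixP => i j; transitivity (\pi_S (w * V (u i) (v j))).
    by rewrite CE !mxE; apply: eq_bigr => c _; rewrite !mxE.
  by rewrite rmorphM /= -zE !mxE.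
rewrite detZ det_map_mx => /(congr1 incl) E.
have : incl (y * (z ^+ n * \pi_S D)) \in P by rewrite E rmorph0 rpred0.
have zXP e : incl z ^+ e \notin P.
  by elim: e => [|e IHe]; rewrite ?idealr1 // exprS prime_idealrM negb_or zP.
by rewrite rmorphM rmorphM rmorphXn !prime_idealrM (negPf yP) (negPf (zXP n)).
Qed.

End Component.

Unset Implicit Arguments.

Theorem theorem1p18 (k : fieldType) (n m d : nat)
    (a : idealr {mpoly k[n.+1]}) (f : 'I_m.+1 -> {mpoly k[n.+1]})
    (a_homog : homogeneous_ideal a)
    (R_reduced : reduced {ideal_quot a})
    (R_dim : krull_dim_ge {ideal_quot a} 1)
    (f_datum : rational_datum a d f) :
  [/\ birational a f <-> jdrank_plus_is a f ((edim a)%:Z - 1),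
      birational a f <->
        (forall P : prime_idealr {ideal_quot a}, minimal_prime P ->
           jdrank_plus_is (preim_ideal P) f ((edim (preim_ideal P))%:Z - 1)) /\
        separates_components a f &
      birational a f ->
      forall (r s : nat) (psi : 'M[{ideal_quot (image_ideal a f)}]_(r + s, n.+1)),
        jacobian_dual psi ->
        [/\ has_rank_one (null_space psi),
            forall e h, homogeneous_null_vector psi e h -> inverse_datum a f e h &
            is_domain {ideal_quot a} -> (1 < edim a)%N ->
            forall rows : 'I_n -> 'I_(r + s),
              has_rank (rowsub rows psi) n ->
              exists e g,
                [/\ homogeneous_null_vector psi e g, inverse_datum a f e g &
                    forall j, \pi_{ideal_quot (image_ideal a f)} (g j)
                              = signed_minor (rowsub rows psi) j]]].
Proof.
have iffE : birational a f <-> jdrank_is a f n by apply: birational_jdrank f_datum.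
have d_gt0 : (0 < d)%N by case: f_datum.
have f_homog j : f j \is d.-homog by case: f_datum.
have f_faithful := datum_faithful R_reduced f_datum.
split=> [||bir r s psi jd].
- by rewrite jdrank_plusE.
- split=> [bir|[jdP sep]].
    split; last exact: (birational_separates a_homog R_reduced f_datum bir).
    move=> P P_min; apply/jdrank_plusE; case: bir => e [g g_inv].
    exact: (preim_jdrank a_homog R_reduced f_datum P_min g_inv).
  apply/iffE/(components_jdrank a_homog R_reduced f_datum sep) => P P_min.
  exact/jdrank_plusE/jdP.
have psi_rank : has_rank psi n.
  case: bir => e [g g_inv].
  exact: (inverse_datum_has_rank a_homog R_reduced f_datum g_inv jd).
split=> [|e h|_ edim_gt1 rows rows_rank].
- exact: (null_space_rank_one a_homog R_reduced f_datum jd psi_rank).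
- exact: (null_vector_inverse_datum a_homog R_reduced f_datum jd psi_rank).
have [e [g [g_null gE]]] :=
  signed_minors_null_datum a_homog R_reduced f_datum jd edim_gt1 rows_rank.
exists e, g; split=> //.
exact: (null_vector_inverse_datum a_homog R_reduced f_datum jd psi_rank g_null).
Qed.
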